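(* Let $k$ be an odd positive integer and let $a_1,\dots,a_k\subset\mathbb{CP}^2$ be a planar complex algebraic billiard such that no mirror $a_j$ contains either of the isotropic points at infinity $I_1=(1:i:0)$, $I_2=(1:-i:0)$. Then the billiard is not $k$-reflective.
   Context: Let $\mathbb{C}^2\subset\mathbb{CP}^2$ be the standard affine chart, equipped with the complex-bilinear quadratic form $dz_1^2+dz_2^2$ (the complexified Euclidean metric); the infinity line is $\mathbb{CP}^2\setminus\mathbb{C}^2$. The isotropic points at infinity are $I_1=(1:i:0)$ and $I_2=(1:-i:0)$. A complex projective line in $\mathbb{CP}^2$ is isotropic if it passes through $I_1$ or $I_2$ (equivalently, it is the infinity line or the quadratic form vanishes on it). The symmetry with respect to a non-isotropic complex line $L$ is the unique non-trivial complex-isometric involution of $\mathbb{C}^2$ fixing the points of $L$; it extends to a projective transformation of $\mathbb{CP}^2$. For $x\in L$, two lines through $x$ are symmetric with respect to $L$ if the symmetry maps one to the other. A planar complex algebraic billiard is a finite collection of complex (projective) algebraic curves (''mirrors'') $a_1,\dots,a_k$ in $\mathbb{CP}^2$ (not necessarily distinct), none of which is an isotropic line. Indices are cyclic: $a_0=a_k$, $a_{k+1}=a_1$. A $k$-periodic billiard orbit is a collection of points $A_j\in a_j$, with $A_{k+1}=A_1$, $A_0=A_k$, such that for every $j=1,\dots,k$: $A_j\neq A_{j+1}$; the tangent line $T_{A_j}a_j$ is not isotropic; and the complex lines $A_{j-1}A_j$ and $A_jA_{j+1}$ are transverse to $T_{A_j}a_j$ (distinct from it) and are symmetric to each other with respect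 to it. (Each point $A_j$ is taken together with a prescribed branch of $a_j$ at $A_j$, which specifies $T_{A_j}a_j$ when $A_j$ is a self-intersection point.) The billiard is $k$-reflective if there exists a non-empty open set of pairs $(A_1,A_2)\in a_1\times a_2$ that extend to $k$-periodic orbits $A_1\dots A_k$. *)

(* Defs.v *)
From HB Require Import structures.
From mathcomp Require Import all_boot all_order all_algebra generic_quotient.
From mathcomp Require Import all_classical all_reals topology normedtype.
From mathcomp Require Import complex.
From mathcomp Require mpoly.
(* The notations of mpoly are incompatible with those of the analysis
   library, and its symmetric shadows that of ssrbool. *)
Import (canonicals, coercions) mpoly.
Import Order.TTheory GRing.Theory Num.Theory numFieldNormedType.Exports.

Set Implicit Arguments.
Unset Strict Implicit.
Unset Printing Implicit Defensive.

Local Open Scope classical_set_scope.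
Local Open Scope quotient_scope.
Local Open Scope ring_scope.

(* The complex numbers, packed so that the norm topology that
   numFieldNormedType puts on every numClosedFieldType is available. *)
Definition Cplx (R : realType) : numClosedFieldType := R[i].

Section ProjectivePlane.
Context {R : realType}.
Local Notation C := (Cplx R).

Definition nonzero_vector : Type :=
  initial_topology (fun v : {v : 'rV[C]_3 | v != 0} => sval v).

Definition nzval (u : nonzero_vector) : 'rV[C]_3 := sval u.

(* Equality of row spaces, i.e. proportionality. *)
Definition proportional (u v : nonzero_vector) : bool :=
  (nzval u == nzval v)%MS.

Lemma proportional_refl : reflexive proportional.
Proof. by move=> u; rewrite /proportional submx_refl. Qed.

Lemma proportional_sym : symmetric proportional.
Proof. by move=> u v; rewrite /proportional andbC. Qed.

Lemma proportional_trans : transitive proportional.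
Proof.
move=> v u w /andP[uv vu] /andP[vw wv]; apply/andP; split.
  exact: submx_trans uv vw.
exact: submx_trans wv vu.
Qed.

Canonical proportional_equiv :=
  EquivRel proportional proportional_refl proportional_sym proportional_trans.

Definition CP2 : Type := quotient_topology {eq_quot proportional_equiv}.
HB.instance Definition _ := Topological.on CP2.
HB.instance Definition _ := Quotient.on CP2.

(* Homogeneous coordinates of p, for some choice of the scale. *)
Definition coords (p : CP2) : 'rV[C]_3 := nzval (repr p).

Fact const1_neq0 : const_mx 1 != 0 :> 'rV[C]_3.
Proof. by apply/eqP => /rowP /(_ 0); rewrite !mxE; exact/eqP/oner_neq0. Qed.

(* The point (v_0 : v_1 : v_2); a junk point when v = 0. *)
Definition hpoint (v : 'rV[C]_3) : CP2 :=
  \pi_CP2 (insubd (exist _ (const_mx 1) const1_neq0 :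
                     {v : 'rV[C]_3 | v != 0}) v : nonzero_vector).

(* The line through the points u and v, when u and v are not proportional. *)
Definition span_line (u v : 'rV[C]_3) : set CP2 :=
  [set p | (coords p <= col_mx u v)%MS].

Definition is_line (L : set CP2) : Prop :=
  exists u v : 'rV[C]_3, \rank (col_mx u v) = 2 /\ L = span_line u v.

Definition join_line (p q : CP2) : set CP2 := span_line (coords p) (coords q).

Definition proj_map (M : 'M[C]_3) (p : CP2) : CP2 := hpoint (coords p *m M).

Definition row3 (x y z : C) : 'rV[C]_3 := \row_(j < 3) [:: x; y; z]`_j.

(* The affine chart is (z1, z2) |-> (z1 : z2 : 1). *)
Definition chart (z : 'rV[C]_2) : CP2 := hpoint (row_mx z 1%:M : 'rV[C]_(2 + 1)).

Definition I1 : CP2 := hpoint (row3 1 'i 0).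
Definition I2 : CP2 := hpoint (row3 1 (- 'i) 0).

Definition isotropic (L : set CP2) : Prop := L I1 \/ L I2.

(* The quadratic form dz1^2 + dz2^2. *)
Definition qform (v : 'rV[C]_2) : C := v 0 0 ^+ 2 + v 0 1 ^+ 2.

(* The affine map z |-> z U + b is a non-trivial complex-isometric involution
   of C^2 that fixes the points of L. *)
Definition is_symmetry (L : set CP2) (U : 'M[C]_2) (b : 'rV[C]_2) : Prop :=
  let f z := z *m U + b in
  [/\ forall v, qform (v *m U) = qform v,
      involutive f,
      ~ f =1 id
    & forall z, L (chart z) -> f z = z].

(* The projective transformation that extends z |-> z U + b. *)
Definition affine_ext (U : 'M[C]_2) (b : 'rV[C]_2) : 'M[C]_3 :=
  (block_mx U 0 b 1%:M : 'M[C]_(2 + 1)).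

Definition symmetric_lines (L l m : set CP2) : Prop :=
  exists U b, is_symmetry L U b /\ proj_map (affine_ext U b) @` l = m.

(* An algebraic curve, not necessarily irreducible; curve_poly need not be
   reduced, since only its zero set and the branches of the latter matter. *)
Record plane_curve := PlaneCurve {
  curve_poly : mpoly.mpoly 3 C;
  curve_degree : nat;
  curve_homog : curve_poly \is mpoly.ishomog1 curve_degree mpoly.mdeg;
  curve_degree_gt0 : (0 < curve_degree)%N;
  curve_poly_neq0 : curve_poly != 0
}.

Definition curve_set (a : plane_curve) : set CP2 :=
  [set p | mpoly.meval (coords p 0) (curve_poly a) = 0].

(* A branch of a at a point, given by a non-constant holomorphic arc
   t |-> sum_n arc_n t^n of C^3 \ 0 lying on the cone over a: the power series
   has a positive radius of convergence and satisfies the equation of a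
   (arc_vanish says so modulo t^N for each N). Modulo arc_0, the leading term
   of the series is arc_m t^m with m = arc_order, so that the line through
   arc_0 and arc_m is the limit of the secants of the branch. *)
Record branch (a : plane_curve) := Branch {
  arc : nat -> 'rV[C]_3;
  arc_order : nat;
  arc_neq0 : arc 0%N != 0;
  arc_lt_order n : (n < arc_order)%N -> (arc n <= arc 0%N)%MS;
  arc_at_order : ~~ (arc arc_order <= arc 0%N)%MS;
  arc_convergent :
    exists M r : C, 0 < r /\ forall n i, `|arc n 0 i| * r ^+ n <= M;
  arc_vanish N n : (n < N)%N ->
    (mpoly.mmap polyC (fun i => \poly_(m < N) arc m 0 i) (curve_poly a))`_n = 0
}.

Definition branch_center (a : plane_curve) (b : branch a) : CP2 :=
  hpoint (arc b 0%N).

Definition tangent_line (a : plane_curve) (b : branch a) : set CP2 :=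
  span_line (arc b 0%N) (arc b (arc_order b)).

Definition algebraic_billiard (k : nat) (a : 'I_k -> plane_curve) : Prop :=
  forall j L, is_line L -> isotropic L -> curve_set (a j) <> L.

(* ord_pred and ordS are the cyclic predecessor and successor on 'I_k. *)
Definition periodic_orbit (k : nat) (a : 'I_k -> plane_curve)
    (A : 'I_k -> CP2) (b : forall j, branch (a j)) : Prop :=
  forall j : 'I_k,
    let T := tangent_line (b j) in
    let l := join_line (A (ord_pred j)) (A j) in
    let m := join_line (A j) (A (ordS j)) in
    [/\ curve_set (a j) (A j) /\ branch_center (b j) = A j,
        A j <> A (ordS j),
        ~ isotropic T,
        l <> T /\ m <> T
      & symmetric_lines T l m].

(* The indices 1, 2 of the mirrors are 0 and its cyclic successor in 'I_k;
   O is an open set of CP2 x CP2 cutting out an open set of a_1 x a_2. *)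
Definition reflective (k : nat) (k_gt0 : (0 < k)%N)
    (a : 'I_k -> plane_curve) : Prop :=
  let j1 := Ordinal k_gt0 in
  let j2 := ordS j1 in
  exists O : set (CP2 * CP2),
    [/\ open O,
        O `&` (curve_set (a j1) `*` curve_set (a j2)) !=set0
      & forall A1 A2, O (A1, A2) -> curve_set (a j1) A1 ->
          curve_set (a j2) A2 ->
          exists A b, [/\ @periodic_orbit k a A b, A j1 = A1 & A j2 = A2]].

End ProjectivePlane.

Arguments CP2 R : clear implicits.
Arguments plane_curve R : clear implicits.

(* Main.v *)
Require Import Defs.
From mathcomp Require Import all_boot all_order all_algebra.
From mathcomp Require Import all_classical all_reals.
From HB Require Import structures.
From mathcomp Require Import generic_quotient complex ring.
From mathcomp Require Import topology normedtype measure lebesgue_measure.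
From mathcomp Require mpoly.
Import (canonicals, coercions) mpoly.
Import Order.TTheory GRing.Theory Num.Theory numFieldNormedType.Exports.
Import Defs.

(** The theorem holds because a generic orbit can be specialized to one whose
    edges are isotropic lines, and isotropic edges alternate between I1 and I2.

    In the coordinates u = z1 + i z2 and v = z1 - i z2 the quadratic form is
    du dv, the direction of the u-axis is I2 and that of the v-axis is I1. The
    symmetry with respect to a line of slope t = dv/du sends the slope s to
    t^2/s (reflection_matrix). Hence, if s_j is the slope of A_j A_(j+1) and
    t_j that of the tangent at A_j, then s_(j-1) s_j = t_j^2. When s_1 tends to
    0 and the t_j stay finite and nonzero, the slopes tend alternately to 0 and
    to infinity; after an odd number k of steps one returns to the edge A_1 A_2
    with the wrong limit.

    The passage to the limit is made with a valuation of the field of complex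
    numbers itself. Let K be a countable algebraically closed subfield that
    contains the coefficients of all mirrors. An open set of a_1 x a_2 is
    uncountable, so it contains a pair (A_1, A_2) such that u(A_1) is not in K
    and u(A_2) is not in a countable algebraically closed field K1 that contains
    K and u(A_1) (nearby_generic_point, countable_alg_closed). Then s_1 is not in
    K1: otherwise the line A_1 A_2 would be a component of a_2 defined over K
    (line_over_subfield), and since A_1 is a generic point of that line, the line
    would be tangent to a_1 at A_1 (tangent_slope_of_line), against
    transversality. So there is a valuation ring V that contains K1 and has s_1
    in its maximal ideal (exists_valuation).

    Call x residually transcendental if x is in V and its residue is not in K.
    The two coordinates of A_1 are so, and this passes from vertex to vertex
    (specialization_step). Here the hypothesis on I1 and I2 enters: an equation
    of a mirror has constant leading coefficients in u and in v, so that u and v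
    are integral over each other, while a vertex cannot escape to infinity along
    an edge whose limit is isotropic. Finally t_j is algebraic over K(u(A_j)), as
    a root of the tangent cone (tangent_slope_algebraic), and all nonzero
    elements that are algebraic over K(u(A_j)) are units of V
    (residually_transcendental_field). This is the sense in which the t_j stay
    finite and nonzero. *)

Set Implicit Arguments.
Unset Strict Implicit.
Unset Printing Implicit Defensive.

Local Open Scope ring_scope.

(** * Subrings and subfields of a field *)

(** Closedness proofs are packed into a structure that is a value, because the
    subrings used below are produced by proofs, for instance by Zorn's
    lemma. *)
Lemma subringClosed_of (R : nzRingType) (X : set R) :
  X 1 -> (forall x y, X x -> X y -> X (x - y)) ->
  (forall x y, X x -> X y -> X (x * y)) ->
  exists V : subringClosed R, forall x, (x \in V) <-> X x.
Proof.
move=> X1 XB XM; pose Xp : {pred R} := fun x => x \in X.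
have cl : subring_closed Xp.
  split; first exact/mem_set.
    by move=> x y /set_mem Xx /set_mem Xy; apply/mem_set/XB.
  by move=> x y /set_mem Xx /set_mem Xy; apply/mem_set/XM.
pose i := GRing.isSubringClosed.Build R Xp cl.
pose V : subringClosed R := HB.pack Xp i.
exists V => x; split; last exact: mem_set.
exact: set_mem.
Qed.

Lemma divringClosed_of (F : fieldType) (X : set F) :
  X 1 -> (forall x y, X x -> X y -> X (x - y)) ->
  (forall x y, X x -> X y -> X (x / y)) ->
  exists K : divringClosed F, forall x, (x \in K) <-> X x.
Proof.
move=> X1 XB XV; pose Xp : {pred F} := fun x => x \in X.
have cl : divring_closed Xp.
  split; first exact/mem_set.
    by move=> x y /set_mem Xx /set_mem Xy; apply/mem_set/XB.
  by move=> x y /set_mem Xx /set_mem Xy; apply/mem_set/XV.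
pose i := GRing.isDivringClosed.Build F Xp cl.
pose K : divringClosed F := HB.pack Xp i.
exists K => x; split; last exact: mem_set.
exact: set_mem.
Qed.

Section SubfieldType.
Variables (F : fieldType) (S : divringClosed F).

(** A type for the subfield S, through which the theory of algebraic elements
    over a field, which is stated for morphisms between field types,
    applies to subfields of F. *)
Definition subfield_type : predArgType := {x : F | x \in S}.
HB.instance Definition _ := [isSub of subfield_type for (@sval _ _)].
HB.instance Definition _ := [Choice of subfield_type by <:].
HB.instance Definition _ := [SubChoice_isSubComUnitRing of subfield_type by <:].
HB.instance Definition _ :=
  [SubComUnitRing_isSubIntegralDomain of subfield_type by <:].
HB.instance Definition _ :=
  [SubIntegralDomain_isSubField of subfield_type by <:].

Lemma polyOver_lift (p : {poly F}) : p \is a polyOver S ->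
  exists q : {poly subfield_type}, p = map_poly val q.
Proof.
move=> /polyOverP pS.
exists (\poly_(i < size p) Sub p`_i (pS i)).
apply/polyP => i; rewrite coef_map coef_poly.
by case: ltnP => [_|h]; rewrite ?SubK // nth_default // raddf0.
Qed.

Lemma algebraicOverP x : algebraicOver (val : subfield_type -> F) x <->
  exists2 p, p != 0 & p \is a polyOver S /\ root p x.
Proof.
split=> [[p p0 px]|[p p0 [pS px]]].
  exists (map_poly val p); first by rewrite map_poly_eq0.
  split=> //; apply/polyOverP => i; rewrite coef_map; exact: valP.
have [q pq] := polyOver_lift pS.
exists q; last by rewrite -pq.
by move: p0; rewrite pq map_poly_eq0.
Qed.

End SubfieldType.

Definition alg_closed_in (F : fieldType) (K : divringClosed F) :=
  forall p x, p \is a polyOver K -> p != 0 -> root p x -> x \in K.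

(** Sums, products, inverses of algebraic elements are algebraic, and so are
    roots of polynomials with algebraic coefficients. *)
Lemma relative_algebraic_closure (F : fieldType) (S : divringClosed F) :
  exists E : divringClosed F,
    [/\ {subset S <= E}, alg_closed_in E &
      forall x, x \in E -> exists2 p, p != 0 & p \is a polyOver S /\ root p x].
Proof.
pose val : {rmorphism subfield_type S -> F} := val.
have [|x y|x y|E EP] :=
  @divringClosed_of F [set x | algebraicOver val x].
- exact: algebraic1.
- exact: algebraic_sub.
- exact: algebraic_div.
exists E; split.
- move=> x xS; apply/EP.
  by rewrite /= (_ : x = val (Sub x xS)) ?SubK//; exact: algebraic_id.
- move=> p x pE p0 px; apply/EP/integral_algebraic.
  apply: (integral_root p0 px) => y yp.
  apply/integral_algebraic/EP.
  exact: (allP (pE : all (mem E) p)).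
- by move=> x /EP /= /algebraicOverP.
Qed.

(** * Valuation rings *)

Section Valuations.
Variable C : fieldType.

Definition is_valuation (V : {pred C}) := forall x, (x \in V) || (x^-1 \in V).

(** With 0^-1 = 0, this is the maximal ideal when V is a valuation ring. *)
Definition nonunits (V : {pred C}) : {pred C} :=
  [pred x | (x == 0) || (x^-1 \notin V)].

Section Theory.
Variables (V : subringClosed C).
Hypothesis valV : is_valuation V.
Local Notation m := (nonunits V).

Lemma nonunits_sub x : x \in m -> x \in V.
Proof.
case/orP => [/eqP->|xV]; first exact: rpred0.
by move: (valV x); rewrite (negbTE xV) orbF.
Qed.

Lemma nonunits_one : 1 \notin m.
Proof. by rewrite !inE oner_eq0 invr1 rpred1. Qed.

Lemma nonunitsM x y : x \in V -> y \in m -> x * y \in m.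
Proof.
move=> xV; case/orP=> [/eqP->|yV]; first by rewrite mulr0 !inE eqxx.
rewrite !inE; have [//|xy0] /= := eqVneq (x * y) 0.
apply: contra yV => xyV.
have /andP[x0 y0] : (x != 0) && (y != 0) by rewrite -negb_or -mulf_eq0.
by rewrite (_ : y^-1 = x * (x * y)^-1) ?rpredM // invfM mulrA mulfV // mul1r.
Qed.

Lemma nonunitsN x : x \in m -> - x \in m.
Proof. by move=> xm; rewrite -mulN1r nonunitsM ?rpredN ?rpred1. Qed.

(** Of x / y and y / x one is in V, so that x + y is a multiple of y or of x. *)
Lemma nonunitsD x y : x \in m -> y \in m -> x + y \in m.
Proof.
have main a b : a \in m -> b \in m -> b != 0 -> a / b \in V -> a + b \in m.
  move=> am bm b0 abV; rewrite (_ : a + b = (a / b + 1) * b).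
    by rewrite nonunitsM ?rpredD ?rpred1.
  by rewrite mulrDl mul1r divfK.
move=> xm ym; have [->|y0] := eqVneq y 0; first by rewrite addr0.
have [->|x0] := eqVneq x 0; first by rewrite add0r.
have /orP[h|h] := valV (x / y); first exact: main.
by rewrite addrC main // -invf_div.
Qed.

Lemma nonunitsB x y : x \in m -> y \in m -> x - y \in m.
Proof. by move=> xm ym; rewrite nonunitsD ?nonunitsN. Qed.

Lemma nonunits0 : 0 \in m.
Proof. by rewrite !inE eqxx. Qed.

Lemma unit_inv x : x \in V -> x \notin m -> x^-1 \in V.
Proof. by move=> _; rewrite !inE negb_or => /andP[_]; rewrite negbK. Qed.

Lemma nonunits_inv x : x \notin V -> x^-1 \in m.
Proof. by move=> xV; rewrite !inE invrK xV orbT. Qed.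

Lemma nonunits_prime x y : x \in V -> y \in V -> x * y \in m ->
  x \in m \/ y \in m.
Proof.
move=> xV yV xym; have [xm|xm] := boolP (x \in m); [by left|right].
have x0 : x != 0 by apply: contra xm => /eqP->; exact: nonunits0.
by rewrite -[y](mulKf x0) nonunitsM // unit_inv.
Qed.

(** Valuation rings are integrally closed: if x is not in V, then dividing the
    equation of x by its leading term writes 1 as a combination of
    positive powers of x^-1, which are nonunits. *)
Lemma valuation_integral (p : {poly C}) x : p \is a polyOver V ->
  (lead_coef p)^-1 \in V -> p != 0 -> root p x -> x \in V.
Proof.
move=> pV lpV p0 px; apply/negPn/negP => xV.
have xm := nonunits_inv xV.
have x0 : x != 0 by apply: contra xV => /eqP->; exact: rpred0.
have sp : (size p).-1.+1 = size p by rewrite prednK // size_poly_gt0.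
have : x^-1 ^+ (size p).-1 * (p.[x] / lead_coef p) \in m.
  by rewrite (rootP px) mul0r mulr0 nonunits0.
rewrite horner_coef -sp big_ord_recr /= mulrDl -lead_coefE.
rewrite [X in _ * (_ + X)]mulrAC divff ?lead_coef_eq0 // mul1r.
rewrite mulrDr -exprMn mulVf // expr1n addrC => h.
have : 1 + - 0 \in m.
  rewrite subr0 -[1](addrK (x^-1 ^+ (size p).-1 * (
     (\sum_(i < (size p).-1) p`_i * x ^+ i) / lead_coef p))) nonunitsB //.
  rewrite mulr_suml mulr_sumr.
  apply: (big_ind (fun y => y \in m)) => [||i _].
  - exact: nonunits0.
  - exact: nonunitsD.
  have -> : x^-1 ^+ (size p).-1 * (p`_i * x ^+ i / lead_coef p) =
     (p`_i / lead_coef p * x^-1 ^+ ((size p).-1 - i).-1) * x^-1.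
    rewrite -[RHS]mulrA -exprSr prednK ?subn_gt0 //.
    have e : x^-1 ^+ i * x ^+ i = 1 by rewrite -exprMn mulVf // expr1n.
    rewrite -[X in _ ^+ X * _](subnK (ltnW (ltn_ord i))) exprD.
    rewrite -[RHS]mulr1 -e; set l := (lead_coef p)^-1; ring.
  apply: nonunitsM => //; rewrite rpredM ?rpredM // ?(polyOverP pV) //.
  by rewrite rpredX // nonunits_sub.
by rewrite subr0 (negbTE nonunits_one).
Qed.

End Theory.
End Valuations.

Section Existence.
Variables (C : fieldType) (K : divringClosed C) (s : C).
Hypotheses (aK : alg_closed_in K) (sK : s \notin K).

Local Notation gen B y := (fun x => exists2 p, p \is a polyOver B & x = p.[y]).

(** The subring B[y]. *)
Lemma adjoin_subring (B : subringClosed C) y : exists B' : subringClosed C,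
  [/\ {subset B <= B'}, y \in B' &
     forall x, x \in B' -> exists2 p, p \is a polyOver B & x = p.[y]].
Proof.
have [|x z|x z|B' B'P] := @subringClosed_of C (gen B y).
- by exists 1; rewrite ?rpred1 ?hornerC.
- by move=> [p pB ->] [q qB ->]; exists (p - q); rewrite ?rpredB // !hornerE.
- by move=> [p pB ->] [q qB ->]; exists (p * q); rewrite ?rpredM // !hornerE.
exists B'; split => [x xB||x /B'P //]; apply/B'P.
  by exists x%:P; rewrite ?polyOverC ?hornerC.
by exists 'X; rewrite ?polyOverX ?hornerX.
Qed.

(** The step of Chevalley's argument that lowers degrees. If s^-1 is in B[x]
    and in B[x^-1], the second relation times s expresses x^n through
    lower powers of x, because 1 - s q_0 is invertible in B. This removes
    the leading term of the first relation. *)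
Lemma valuation_descent (B : subringClosed C) x p q :
    (forall b, b \in B -> 1 - s * b != 0 /\ (1 - s * b)^-1 \in B) ->
    s != 0 -> s \in B -> x != 0 ->
    p \is a polyOver B -> q \is a polyOver B ->
    (size q <= size p)%N -> s^-1 = p.[x] -> s^-1 = q.[x^-1] ->
  exists2 r, r \is a polyOver B & (size r < size p)%N /\ s^-1 = r.[x].
Proof.
move=> jac s0 sB x0 pB qB.
case Ep: (size p) => [|n].
  by move/eqP: Ep; rewrite size_poly_eq0 => /eqP -> _ /eqP;
     rewrite horner0 invr_eq0 (negbTE s0).
move=> sq px qx; have /polyOverP pBi := pB; have /polyOverP qBi := qB.
have [c0 cB] := jac _ (qBi 0%N).
set c := 1 - s * q`_0 in c0 cB.
have xn : x ^+ n = s * c^-1 * \sum_(i < n) q`_i.+1 * x ^+ (n - i.+1).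
  apply: (mulfI c0); rewrite (mulrC s) !mulrA divff // mul1r.
  rewrite mulrBl mul1r -[X in X - _]mul1r -(divff s0) qx.
  rewrite (horner_coef_wide _ sq) big_ord_recl /= expr0 mulr1.
  rewrite !mulrDr mulrDl [s * _ * _ + _]addrC addrK.
  rewrite -mulrA mulr_suml; congr (_ * _); apply: eq_bigr => i _.
  rewrite -mulrA; congr (_ * _).
  have le : ((x == 0%R) + i.+1 <= n)%N by rewrite (negbTE x0) ltn_ord.
  by rewrite /bump /= add1n exprVn (expfB_cond le) mulrC.
exists (\poly_(i < n) p`_i +
        (p`_n * (s * c^-1)) *: \sum_(i < n) q`_i.+1 *: 'X^(n - i.+1)).
  apply: rpredD; first by apply/polyOverP=> i; rewrite coef_poly; case: ifP => // _; rewrite rpred0.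
  apply: polyOverZ; first by rewrite !rpredM.
  by apply: rpred_sum => i _; rewrite polyOverZ ?qBi // rpredX // polyOverX.
split.
  rewrite ltnS (leq_trans (size_polyD _ _)) // geq_max size_poly /=.
  rewrite (leq_trans (size_scale_leq _ _)) //.
  rewrite (leq_trans (size_sum _ _ _)) //; apply/bigmax_leqP => i _.
  rewrite (leq_trans (size_scale_leq _ _)) // size_polyXn.
  by rewrite subnSK // leq_subr.
rewrite px horner_coef Ep big_ord_recr /= hornerD horner_poly; congr (_ + _).
rewrite hornerZ -mulrA xn; congr (_ * (_ * _)); rewrite horner_sum.
by apply: eq_bigr => i _; rewrite hornerZ hornerXn.
Qed.

(* The empty set is admitted because the union of the empty chain is empty. *)
Let admissible (X : set C) := X = set0 \/
  exists B : subringClosed C, [/\ {subset K <= B}, s \in B, s^-1 \notin B &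
    forall x, X x <-> x \in B].

(** A subring that contains K and s and is maximal for not containing s^-1 is
    a valuation ring; K[s] does not contain s^-1 because s is
    transcendental over K. *)
Lemma exists_valuation : exists V : subringClosed C,
  [/\ is_valuation V, {subset K <= V} & s \in nonunits V].
Proof.
have s0 : s != 0 by apply: contra sK => /eqP ->; exact: rpred0.
have [|X [adX maxX]] := @Zorn_bigcup C admissible.
  move=> F FP tot.
  have [[X FX [x Xx]]|noX] := pselect (exists2 X, F X & exists x, X x); last first.
    left; apply/seteqP; split=> // x [X FX Xx]; apply: noX; exists X => //.
    by exists x.
  have ad Y y : F Y -> Y y -> exists B : subringClosed C,
     [/\ {subset K <= B}, s \in B, s^-1 \notin B & forall x, Y x <-> x \in B].
    by move=> /FP[->//|//].
  have two Y Z y z : F Y -> F Z -> Y y -> Z z -> exists W, [/\ F W, W y & W z].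
    move=> FY FZ Yy Zz; have [YZ|ZY] := tot _ _ FY FZ.
      by exists Z; split=> //; apply: YZ.
    by exists Y; split=> //; apply: ZY.
  have [B [KB sB sB' XB]] := ad _ _ FX Xx.
  right; have [|y z [Y FY Yy] [Z FZ Zz]|y z [Y FY Yy] [Z FZ Zz]|U UP] :=
    @subringClosed_of C (\bigcup_(Y in F) Y).
  - by exists X => //; apply/XB; rewrite rpred1.
  - have [W [FW Wy Wz]] := two _ _ _ _ FY FZ Yy Zz.
    exists W => //; have [D [_ _ _ DW]] := ad _ _ FW Wy.
    by apply/DW; rewrite rpredB //; apply/DW.
  - have [W [FW Wy Wz]] := two _ _ _ _ FY FZ Yy Zz.
    exists W => //; have [D [_ _ _ DW]] := ad _ _ FW Wy.
    by apply/DW; rewrite rpredM //; apply/DW.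
  exists U; split => [y yK|||y].
  - by apply/UP; exists X => //; apply/XB/KB.
  - by apply/UP; exists X => //; apply/XB.
  - apply/negP => /UP[Y FY Ys]; have [D [_ _ /negP sD DY]] := ad _ _ FY Ys.
    by apply/sD/DY.
  by rewrite UP.
(* The maximal set is not empty, because K[s] is admissible. *)
have [X0|[B [KB sB sB' XB]]] := adX.
  have [B [KB sB BP]] := adjoin_subring K s.
  case: (maxX (fun x => x \in B)).
    rewrite X0; split=> // /(_ s); exact.
  right; exists B; split=> //; apply/negP => /BP[p pK sp].
  case/negP: sK; apply: (aK (p := 'X * p - 1)).
  - by rewrite rpredB ?rpred1 // rpredM ?polyOverX.
  - apply/eqP => /(congr1 (fun r : {poly C} => r.[0])).
    by rewrite !hornerE /= => /eqP; rewrite oppr_eq0 oner_eq0.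
  - by rewrite /root !hornerE -sp divff // subrr.
have max (B' : subringClosed C) :
    {subset B <= B'} -> s^-1 \notin B' -> {subset B' <= B}.
  move=> BB' sB'' x xB'; apply/negPn/negP => /negP xB.
  case: (maxX (fun x => x \in B')).
    split; first by move=> y /XB /BB'.
    by move/(_ x xB')/XB.
  by right; exists B'; split=> // [y /KB|]; [exact: BB'|exact: BB'].
(* s lies in every maximal ideal of B: if s^-1 were a polynomial in the inverse
   of c = 1 - s b, then multiplying by a power of c, which is 1 modulo s B,
   would put s^-1 in B. *)
have jac b : b \in B -> 1 - s * b != 0 /\ (1 - s * b)^-1 \in B.
  move=> bB; set c := 1 - s * b.
  have c0 : c != 0.
    apply: contra sB' => /eqP/(canRL (subrK _)); rewrite add0r => e.
    by rewrite -[s^-1]mulr1 e mulKf.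
  split=> //; have [B' [BB' cB' B'P]] := adjoin_subring B c^-1.
  apply: (max _ BB' _ _ cB'); apply/negP => /B'P[p /polyOverP pB sp].
  have h n : exists2 b', b' \in B & c ^+ n = 1 - s * b'.
    elim: n => [|n [b' b'B e]]; first by exists 0; rewrite ?rpred0 // mulr0 subr0.
    exists (b' + b - b' * s * b); first by rewrite rpredB ?rpredD ?rpredM // rpredM.
    rewrite exprSr e /c; ring.
  have [b' b'B e] := h (size p).
  case/negP: sB'; rewrite -[s^-1](subrK b') rpredD //.
  have -> : s^-1 - b' = \sum_(i < size p) p`_i * c ^+ (size p - i).
    have -> : s^-1 - b' = s^-1 * c ^+ size p by rewrite e mulrBr mulr1 mulKf.
    rewrite sp horner_coef mulr_suml; apply: eq_bigr => i _.
    rewrite -mulrA exprVn [c ^- _ * _]mulrC; congr (_ * _).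
    have le : ((c == 0%R) + i <= size p)%N by rewrite (negbTE c0) ltnW // ltn_ord.
    by rewrite (expfB_cond le).
  by apply: rpred_sum => i _; rewrite rpredM // rpredX // rpredB ?rpred1 ?rpredM.
exists B; split=> //; last by rewrite !inE sB' orbT.
move=> x; apply/negPn/negP; rewrite negb_or => /andP[xB xB'].
have x0 : x != 0 by apply: contra xB => /eqP->; exact: rpred0.
have adj y : y \notin B -> exists2 p, p \is a polyOver B & s^-1 = p.[y].
  move=> yB; have [B' [BB' yB' B'P]] := adjoin_subring B y.
  by apply: B'P; apply: contraNT yB => /(max _ BB'); apply.
have [p pB px] := adj _ xB; have [q qB qx] := adj _ xB'.
(* Infinite descent on the total degree of the two relations; the roles of x
   and x^-1 are exchanged when q has the larger degree. *)
have [N] := ubnP (size p + size q); clear xB xB' adj.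
elim: N p q x x0 pB qB px qx => // N IH p q x x0 pB qB px qx.
rewrite ltnS => le; have [qp|/ltnW pq] := leqP (size q) (size p).
  have [r rB [sr rx]] := valuation_descent jac s0 sB x0 pB qB qp px qx.
  apply: (IH r q x) => //; apply: leq_trans le; by rewrite ltn_add2r.
have x'0 : x^-1 != 0 by rewrite invr_eq0.
have px' : s^-1 = p.[x^-1^-1] by rewrite invrK.
have [r rB [sr rx]] := valuation_descent jac s0 sB x'0 qB pB pq qx px'.
by apply: (IH p r x) => //; apply: leq_trans le; rewrite ltn_add2l.
Qed.

End Existence.

(** * Residually transcendental elements *)

Section ResiduallyTranscendental.
Variables (C : closedFieldType) (V : subringClosed C) (K : divringClosed C).
Hypotheses (valV : is_valuation V) (KV : {subset K <= V}).
Hypothesis aK : alg_closed_in K.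
Local Notation m := (nonunits V).

(** Since K is algebraically closed, this says that the residue of u in V / m
    is transcendental over the image of K. *)
Definition residually_transcendental u :=
  u \in V /\ forall a, a \in K -> u - a \notin m.

Lemma subfield_unit a : a \in K -> a != 0 -> a \notin m.
Proof.
by move=> aKK a0; rewrite !inE negb_or a0 negbK KV // rpredV.
Qed.

Lemma residually_transcendental_congr u v :
  residually_transcendental u -> v - u \in m -> residually_transcendental v.
Proof.
move=> [uV um] vu; split.
  by rewrite -[v](subrK u) rpredD // nonunits_sub.
move=> a aKK; apply: contra (um a aKK) => va.
have -> : u - a = (v - a) - (v - u) by ring.
exact: nonunitsB.
Qed.

(** Over the algebraically closed K the polynomial q splits, and each of its
    factors takes a unit value at u. *)
Lemma horner_residually_transcendental u (q : {poly C}) :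
  residually_transcendental u -> q \is a polyOver K -> q != 0 -> q.[u] \notin m.
Proof.
move=> [uV um] qK q0; have [r Eq] := closed_field_poly_normal q.
have rK : all (mem K) r.
  apply/allP => z zr; apply: (aK qK q0).
  by rewrite Eq rootZ ?lead_coef_eq0 // root_prod_XsubC.
have lK : lead_coef q \in K by rewrite lead_coefE (polyOverP qK).
rewrite Eq hornerZ horner_prod.
have goodM x y : (x \in V) && (x \notin m) -> (y \in V) && (y \notin m) ->
    (x * y \in V) && (x * y \notin m).
  move=> /andP[xV xm] /andP[yV ym]; rewrite rpredM //=.
  by apply/negP => /(nonunits_prime xV yV)[]; exact/negP.
suff /andP[] : (lead_coef q * \prod_(z <- r) ('X - z%:P).[u] \in V) &&
   (lead_coef q * \prod_(z <- r) ('X - z%:P).[u] \notin m) by [].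
apply: (goodM); first by rewrite KV // subfield_unit ?lead_coef_eq0.
clear Eq; elim: r rK => [_|z r IH /= /andP[zK rK]].
  by rewrite big_nil rpred1 nonunits_one.
rewrite big_cons; apply: (goodM); last exact: IH.
by rewrite !hornerE um // rpredB // KV.
Qed.

(** By horner_residually_transcendental the field K(u) is contained in V. As V
    is integrally closed, it contains the algebraic closure of K(u) as
    well, and this closure is a field: all its nonzero elements are units
    of V. *)
Lemma residually_transcendental_field u : residually_transcendental u ->
  exists E : divringClosed C, [/\ {subset K <= E}, u \in E, alg_closed_in E &
    {subset E <= V}].
Proof.
move=> tu; have qu0 (q : {poly C}) : q \is a polyOver K -> q != 0 -> q.[u] != 0.
  move=> qK q0; apply: contra (horner_residually_transcendental tu qK q0).
  by move=> /eqP->; exact: nonunits0.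
have pV (p : {poly C}) : p \is a polyOver K -> p.[u] \in V.
  move=> /polyOverP pK; rewrite horner_coef; apply: rpred_sum => i _.
  by apply: rpredM; [exact/KV|apply: rpredX; case: tu].
pose X z := exists p q : {poly C}, [/\ p \is a polyOver K, q \is a polyOver K,
  q != 0 & z = p.[u] / q.[u]].
have [|x y|x y|S SP] := @divringClosed_of C X.
- by exists 1, 1; rewrite rpred1 oner_neq0 hornerC divr1.
- move=> [p [q [pK qK q0 ->]]] [p' [q' [pK' qK' q0' ->]]].
  exists (p * q' - p' * q), (q * q').
  rewrite rpredB ?rpredM // mulf_neq0 //; split=> //.
  have := qu0 _ qK q0; have := qu0 _ qK' q0'; rewrite !hornerE => h1 h2.
  by rewrite -mulNr addf_div // mulNr.
- move=> [p [q [pK qK q0 ->]]] [p' [q' [pK' qK' q0' ->]]].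
  have [->|p0'] := eqVneq p' 0.
    by exists 0, 1; rewrite rpred0 rpred1 oner_neq0 horner0 !mul0r invr0 mulr0.
  exists (p * q'), (q * p').
  rewrite ?rpredM // mulf_neq0 //; split=> //.
  by rewrite !hornerE invf_div mulf_div.
have SV : {subset S <= V}.
  move=> z /SP[p [q [pK qK q0 ->]]]; rewrite rpredM ?pV //.
  by rewrite unit_inv ?pV ?horner_residually_transcendental.
have [E [SE aE EP]] := relative_algebraic_closure S.
exists E; split=> //.
- move=> a aKK; apply/SE/SP; exists a%:P, 1.
  by rewrite polyOverC rpred1 oner_neq0 !hornerC divr1.
- apply/SE/SP; exists 'X, 1.
  by rewrite polyOverX rpred1 oner_neq0 !hornerC hornerX divr1.
- move=> x /EP[p p0 [pS px]].
  apply: (valuation_integral valV _ _ p0 px).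
    by apply/polyOverP=> i; apply/SV/(polyOverP pS).
  by apply: SV; rewrite rpredV lead_coefE (polyOverP pS).
Qed.

End ResiduallyTranscendental.

(** * Ternary forms and their restrictions to lines *)

Section Form.
Variables (C : fieldType) (F : mpoly.mpoly 3 C).

(** The morphism f embeds the coefficients into the ring of the coordinates;
    this ring is the field itself for values, or a ring of polynomials for
    restrictions to lines and arcs. *)
Definition feval (A : comNzRingType) (f : C -> A) (P : 'rV[A]_3) : A :=
  mpoly.mmap f (fun i => P 0 i) F.

Lemma fevalE (A : comNzRingType) (f : C -> A) (P : 'rV[A]_3) :
  feval f P =
  \sum_(m <- mpoly.msupp F) f (mpoly.mcoeff m F) * \prod_i P 0 i ^+ mpoly.fun_of_multinom m i.
Proof. by []. Qed.

Lemma feval_rmorph (A B : comNzRingType) (phi : {rmorphism A -> B}) f g P :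
  phi \o f =1 g -> phi (feval f P) = feval g (map_mx phi P).
Proof.
move=> fg; rewrite !fevalE rmorph_sum; apply: eq_bigr => m _.
rewrite rmorphM -fg /= rmorph_prod; congr (_ * _); apply: eq_bigr => i _.
by rewrite rmorphXn mxE.
Qed.

(** A polynomial map respects congruences. The congruence is given by an ideal
    I of a subring S, to cover both the maximal ideal of a valuation ring
    and the multiples of a power of the variable. *)
Lemma feval_cong (A : comNzRingType) (S : subringClosed A) (I : {pred A}) f (P Q : 'rV[A]_3) :
  (forall x y, x \in I -> y \in I -> x + y \in I) ->
  (forall x y, x \in S -> y \in I -> x * y \in I) -> 0 \in I ->
  (forall m, f (mpoly.mcoeff m F) \in S) ->
  (forall i, P 0 i \in S) -> (forall i, Q 0 i \in S) ->
  (forall i, P 0 i - Q 0 i \in I) -> feval f P - feval f Q \in I.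
Proof.
move=> ID IM I0 fS PS QS PQ; rewrite !fevalE -sumrB.
have I2 x y x' y' : x \in S -> y' \in S -> x - x' \in I -> y - y' \in I ->
    x * y - x' * y' \in I.
  move=> xS yS h1 h2; have -> : x * y - x' * y' = x * (y - y') + y' * (x - x').
    ring.
  by rewrite ID // IM.
apply: (big_ind (fun x => x \in I)) => // m _; rewrite -mulrBr IM //.
suff : [&& \prod_i P 0 i ^+ mpoly.fun_of_multinom m i \in S,
  \prod_i Q 0 i ^+ mpoly.fun_of_multinom m i \in S &
  \prod_i P 0 i ^+ mpoly.fun_of_multinom m i - \prod_i Q 0 i ^+ mpoly.fun_of_multinom m i \in I] by case/and3P.
apply: (big_ind2 (fun x y => [&& x \in S, y \in S & x - y \in I])).
- by rewrite !rpred1 subrr.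
- move=> x1 x2 y1 y2 /and3P[? ? ?] /and3P[? ? ?].
  by rewrite !rpredM //= I2.
move=> i _; rewrite !rpredX //=.
elim: (mpoly.fun_of_multinom m i) => [|n IH]; first by rewrite subrr.
by rewrite !exprS I2 // rpredX.
Qed.

Lemma feval_mem (A : comNzRingType) (S : subringClosed A) f (P : 'rV[A]_3) :
  (forall m, f (mpoly.mcoeff m F) \in S) ->
  (forall i, P 0 i \in S) -> feval f P \in S.
Proof.
move=> fS PS; rewrite fevalE rpred_sum // => m _.
by rewrite rpredM // rpred_prod // => i _; rewrite rpredX.
Qed.

Variable d : nat.
Hypothesis homF : F \is mpoly.ishomog1 d mpoly.mdeg.

Lemma msupp_deg m : m \in mpoly.msupp F -> (\sum_i mpoly.fun_of_multinom m i)%N = d.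
Proof. by move=> mF; have /mpoly.dhomogP/(_ m mF) <- := homF; rewrite /= mpoly.mdegE. Qed.

Lemma fevalZ (A : comNzRingType) (f : C -> A) c P :
  feval f (c *: P) = c ^+ d * feval f P.
Proof.
rewrite !fevalE mulr_sumr !big_seq; apply: eq_bigr => m mF.
rewrite mulrCA -(msupp_deg mF); congr (_ * _).
rewrite expr_sum -big_split; apply: eq_bigr => i _.
by rewrite mxE exprMn.
Qed.

Definition line_poly (A B : 'rV[C]_3) : {poly C} :=
  feval polyC (map_mx polyC A + 'X *: map_mx polyC B).

Lemma horner_line_poly A B x : (line_poly A B).[x] = feval idfun (A + x *: B).
Proof.
rewrite -/(horner_eval x _) (feval_rmorph (g := idfun)); last first.
  by move=> c /=; rewrite /horner_eval hornerC.
congr feval; apply/rowP => i; rewrite !mxE /= /horner_eval.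
by rewrite !hornerE.
Qed.

(* c is the coefficient of degree n, zero if the degree is smaller, so that
   the relation is multiplicative. *)
Let bounded n (p : {poly C}) c := (size p <= n.+1)%N /\ p`_n = c.

Let boundedM n1 n2 p1 p2 c1 c2 : bounded n1 p1 c1 -> bounded n2 p2 c2 ->
  bounded (n1 + n2) (p1 * p2) (c1 * c2).
Proof.
move=> [s1 <-] [s2 <-]; split.
  rewrite (leq_trans (size_polyMleq _ _)) //.
  by rewrite -subn1 leq_subLR (leq_trans (leq_add s1 s2)) // addnS.
rewrite coefM (bigD1 (inord n1)) //= inordK ?ltnS ?leq_addr // addKn.
rewrite big1 ?addr0 // => i; rewrite -val_eqE /= inordK ?ltnS ?leq_addr // => ne.
have [lt|gt|e] := ltngtP i n1; last by rewrite e eqxx in ne.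
  rewrite (nth_default 0 (s := p2)) ?mulr0 // (leq_trans s2) //.
  by rewrite ltn_subRL ltn_add2r.
by rewrite (nth_default 0 (s := p1)) ?mul0r // (leq_trans s1).
Qed.

(** The coefficient of degree d does not depend on A because F is homogeneous
    of degree d. In particular it is constant along a pencil of parallel
    lines. *)
Lemma line_poly_bounded A B :
  (size (line_poly A B) <= d.+1)%N /\ (line_poly A B)`_d = feval idfun B.
Proof.
rewrite /line_poly !fevalE coef_sum.
suff h m : m \in mpoly.msupp F -> bounded d
    ((mpoly.mcoeff m F)%:P * \prod_(i < 3) (map_mx polyC A + 'X *: map_mx polyC B) 0 i ^+ mpoly.fun_of_multinom m i)
    (mpoly.mcoeff m F * \prod_(i < 3) B 0 i ^+ mpoly.fun_of_multinom m i).
  split; last by rewrite !big_seq; apply: eq_bigr => m /h[].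
  rewrite big_seq (leq_trans (size_sum _ _ _)) //; apply/bigmax_leqP_seq => m _.
  by move=> /h[].
move=> mF; rewrite -[d in bounded d](msupp_deg mF) -[(\sum_i _)%N]add0n.
apply: boundedM.
  by split; rewrite ?coefC // size_polyC leq_b1.
apply: (big_ind3 (fun n p c => bounded n p c)) => [||i _].
- by split; rewrite ?coef1 // size_poly1.
- by move=> ? ? ? ? ? ?; exact: boundedM.
elim: (mpoly.fun_of_multinom m i) => [|n IH].
  by rewrite !expr0; split; rewrite ?coef1 // size_poly1.
rewrite !exprS -add1n; apply: boundedM => //.
rewrite !mxE; split; last by rewrite coefD coefC add0r coefXM coefC.
rewrite (leq_trans (size_polyD _ _)) // geq_max size_polyC.
rewrite (leq_trans (leq_b1 _)) //=.
by rewrite mulrC mul_polyC (leq_trans (size_scale_leq _ _)) ?size_polyX.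
Qed.

Lemma line_poly_lead A B : feval idfun B != 0 ->
  line_poly A B != 0 /\ lead_coef (line_poly A B) = feval idfun B.
Proof.
move=> B0; have [s c] := line_poly_bounded A B.
have sE : size (line_poly A B) = d.+1.
  apply/eqP; rewrite eqn_leq s /= ltnNge; apply/negP => s'.
  by move: B0; rewrite -c nth_default ?eqxx.
by rewrite -size_poly_gt0 sE lead_coefE sE.
Qed.

Lemma line_poly_over (S : subringClosed C) (A B : 'rV[C]_3) :
  (forall m, mpoly.mcoeff m F \in S) -> (forall i, A 0 i \in S) ->
  (forall i, B 0 i \in S) -> line_poly A B \is a polyOver S.
Proof.
move=> FS AS BS; apply: feval_mem => [m|i]; first by rewrite polyOverC.
by rewrite !mxE rpredD ?rpredM ?polyOverX ?polyOverC.
Qed.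

End Form.

(** * Specialization of the vertices of an orbit *)

Section Specialization.
Variables (C : closedFieldType) (V : subringClosed C) (K : divringClosed C).
Hypotheses (valV : is_valuation V) (KV : {subset K <= V}).
Hypothesis aK : alg_closed_in K.
Local Notation m := (nonunits V).
Variables (F : mpoly.mpoly 3 C) (d : nat).
Hypothesis homF : F \is mpoly.ishomog1 d mpoly.mdeg.
Hypothesis FK : forall n, mpoly.mcoeff n F \in K.
Local Notation ev P := (feval F idfun P).

Variables e1 e2 e3 : 'rV[C]_3.
Hypotheses (e1K : forall i, e1 0 i \in K) (e2K : forall i, e2 0 i \in K)
  (e3K : forall i, e3 0 i \in K).
Local Notation pt x y w := (x *: e1 + y *: e2 + w *: e3).

Let ptS (S : subringClosed C) x y w i : {subset K <= S} ->
  x \in S -> y \in S -> w \in S -> (pt x y w) 0 i \in S.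
Proof.
move=> KS xS yS wS; rewrite !mxE.
by rewrite !rpredD ?rpredM // KS.
Qed.

Lemma feval_congr_nonunits x y w x' y' w' :
  x \in V -> y \in V -> w \in V -> x' \in V -> y' \in V -> w' \in V ->
  x - x' \in m -> y - y' \in m -> w - w' \in m ->
  ev (pt x y w) - ev (pt x' y' w') \in m.
Proof.
move=> xV yV wV xV' yV' wV' xx yy ww.
apply: (feval_cong (S := V)) => [a b|a b||n|i|i|i].
- exact: nonunitsD.
- exact: nonunitsM.
- exact: nonunits0.
- exact/KV/FK.
- exact: ptS.
- exact: ptS.
rewrite !mxE (_ : _ - _ = e1 0 i * (x - x') + e2 0 i * (y - y') + e3 0 i * (w - w')).
  by rewrite !nonunitsD // nonunitsM // KV.
by ring.
Qed.

Hypotheses (Fe1 : ev e1 != 0) (Fe2 : ev e2 != 0).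

Lemma feval_over (S : divringClosed C) (P : 'rV[C]_3) : {subset K <= S} ->
  (forall i, P 0 i \in S) -> ev P \in S.
Proof. by move=> KS PS; apply: feval_mem => // n; exact/KS/FK. Qed.

(** A point of the curve cannot specialize to e1, where F takes a nonzero
    value in K. *)
Lemma curve_avoids x y w : ev (pt x y w) = 0 -> x != 0 ->
  y / x \in m -> w / x \in m -> False.
Proof.
move=> F0 x0 ym wm; have : ev (pt 1 (y / x) (w / x)) - ev (pt 1 0 0) \in m.
  apply: feval_congr_nonunits; rewrite ?rpred0 ?rpred1 ?subr0 ?subrr //.
  - exact: nonunits_sub.
  - exact: nonunits_sub.
  - exact: nonunits0.
have -> : pt 1 (y / x) (w / x) = x^-1 *: pt x y w.
  by rewrite !scalerDr !scalerA mulVf // ![x^-1 * _]mulrC.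
rewrite (fevalZ homF) F0 mulr0 sub0r scale1r !scale0r !addr0 => h.
have e1m : ev e1 \in m by rewrite -[ev e1]opprK nonunitsN.
by move/negP: (subfield_unit KV (feval_over (S:=K) (fun _ => id) e1K) Fe1).
Qed.

(** On the curve, x is integral over K[y], since F(e1) is a constant leading
    coefficient. If x had residue a in K, then y would be, modulo the
    maximal ideal, a root of the nonzero polynomial F(a, Y, 1) over K. *)
Lemma curve_residually_transcendental x y :
  residually_transcendental V K y -> ev (pt x y 1) = 0 ->
  residually_transcendental V K x.
Proof.
move=> ty F0; have [yV _] := ty; have K1 : 1 \in K := rpred1 _.
have lK (P : 'rV[C]_3) : (forall i, P 0 i \in K) -> ev P \in K by apply: feval_over.
have xV : x \in V.
  have [p0 pl] := line_poly_lead homF (y *: e2 + e3) Fe1.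
  apply: (valuation_integral valV _ _ p0).
  - apply: line_poly_over => [n|i|i]; try exact/KV.
    by rewrite !mxE rpredD ?rpredM // KV.
  - by rewrite pl KV // rpredV lK.
  rewrite /root horner_line_poly.
  by rewrite (_ : _ + _ = pt x y 1) ?F0 // scale1r addrC addrA.
split=> // a aKK; apply/negP => xa.
have [p0 pl] := line_poly_lead homF (a *: e1 + e3) Fe2.
have pK : line_poly F (a *: e1 + e3) e2 \is a polyOver K.
  apply: line_poly_over => // i.
  by rewrite !mxE rpredD ?rpredM.
case/negP: (horner_residually_transcendental KV aK ty pK p0).
rewrite horner_line_poly (_ : _ + y *: e2 = pt a y 1); last by rewrite scale1r [RHS]addrAC.
rewrite -[ev _]subr0 -F0 -opprB nonunitsN //.
apply: feval_congr_nonunits; rewrite ?rpred1 ?subrr ?nonunits0 //.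
exact: KV.
Qed.

(** The point Q = (x : y : w) is joined to (u, v) by a line whose slope
    vanishes modulo the maximal ideal. If Q were at infinity or x / w were
    not in V, then y / x and w / x would be nonunits, which curve_avoids
    excludes; so the second coordinate of Q has the residue of v. *)
Lemma specialization_step u v x y w :
  residually_transcendental V K u -> residually_transcendental V K v ->
  ev (pt x y w) = 0 -> x - w * u != 0 -> (y - w * v) / (x - w * u) \in m ->
  [/\ w != 0, residually_transcendental V K (x / w) &
      residually_transcendental V K (y / w)].
Proof.
move=> tu tv F0 p0; set s := _ / _ => sm.
have Ey : y = w * v + s * (x - w * u) by rewrite /s divfK // addrC subrK.
have [uV _] := tu; have [vV _] := tv; have sV := nonunits_sub valV sm.
have [w0|w0] := eqVneq w 0.
  move: Ey p0; rewrite w0 !mul0r subr0 add0r => Ey x0.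
  case: (curve_avoids F0 x0); first by rewrite Ey mulfK.
  by rewrite w0 mul0r nonunits0.
set X := x / w; set Y := y / w.
have F1 : ev (pt X Y 1) = 0.
  have -> : pt X Y 1 = w^-1 *: pt x y w.
    by rewrite !scalerDr !scalerA mulVf // ![w^-1 * _]mulrC.
  by rewrite (fevalZ homF) F0 mulr0.
have EY : Y = v + s * (X - u).
  by rewrite /Y /X [in LHS]Ey; field.
suff XV : X \in V.
  have tY : residually_transcendental V K Y.
    apply: (residually_transcendental_congr valV tv).
    rewrite EY [v + _]addrC addrK mulrC nonunitsM // rpredB //.
  by split=> //; exact: curve_residually_transcendental F1.
apply/negPn/negP => XV; have X'm := nonunits_inv XV.
have X0 : X != 0 by apply: contra XV => /eqP->; exact: rpred0.
apply: (curve_avoids F1 X0); last by rewrite mul1r.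
have -> : Y / X = v * X^-1 + (1 - u * X^-1) * s by rewrite EY; field.
apply: nonunitsD => //; apply: nonunitsM => //.
by rewrite rpredB ?rpred1 // rpredM // nonunits_sub.
Qed.

End Specialization.

(** * Tangents of arcs on a curve *)

Section TruncatedSeries.
Variable C : fieldType.

Lemma dvd_polyXn (p : {poly C}) N : (forall n, (n < N)%N -> p`_n = 0) -> 'X^N %| p.
Proof.
move=> p0; rewrite -[p](poly_take_drop N) [take_poly N p](_ : _ = 0).
  by rewrite add0r dvdp_mull.
by apply/polyP => i; rewrite coef_take_poly coef0; case: ifP => // /p0.
Qed.

Lemma dvdX_horner0 (p : {poly C}) : ('X %| p) = (p.[0] == 0).
Proof. by rewrite -[RHS]/(root p 0) -dvdp_XsubCl polyC0 subr0. Qed.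

(** Power series with nonzero constant term are invertible; here modulo a
    power of the variable, since arcs are only used through their
    truncations. *)
Lemma truncated_inverse N (p : {poly C}) : p.[0] != 0 ->
  exists q, 'X^N %| q * p - 1.
Proof.
move=> p0; have : coprimep p 'X^N by rewrite coprimep_expr // coprimepX.
move=> /Bezout_eq1_coprimepP[[a b] /= e]; exists a.
by rewrite -e opprD addrA subrr sub0r dvdpNr dvdp_mull.
Qed.

(** A bundled morphism, so that it commutes with the evaluation of forms
    (eval2_feval). *)
Definition eval2 (a b : {poly C}) : {rmorphism {poly {poly C}} -> {poly C}} :=
  horner_eval b \o map_poly (comp_poly a).

Lemma eval2E a b G : eval2 a b G = (map_poly (comp_poly a) G).[b].
Proof. by []. Qed.

Lemma eval2C a b c : eval2 a b c%:P%:P = c%:P.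
Proof. by rewrite eval2E map_polyC hornerC /= comp_polyC. Qed.

Lemma eval2X a b : eval2 a b 'X = b.
Proof. by rewrite eval2E map_polyX hornerX. Qed.

Lemma eval2Xi a b : eval2 a b ('X%:P) = a.
Proof. by rewrite eval2E map_polyC hornerC /= comp_polyX. Qed.

(** Substitute b = t^m b1(t) for the outer variable of G. The lowest power of
    that variable in G gives the leading coefficient of the result, and
    this must vanish as soon as the result vanishes to higher order. *)
Lemma eval2_lowest (G : {poly {poly C}}) : G != 0 ->
  exists n, G`_n != 0 /\ forall m (a b : {poly C}), (0 < m)%N ->
    'X^((m * n).+1) %| eval2 a ('X^m * b) G -> b.[0] ^+ n * (G`_n).[a.[0]] = 0.
Proof.
move=> G0; have ex : exists n, G`_n != 0.
  by exists (size G).-1; rewrite -lead_coefE lead_coef_eq0.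
have [n Gn min] := ex_minnP ex; exists n; split=> // m a b m0.
have -> : G = drop_poly n G * 'X^n.
  rewrite -[LHS](poly_take_drop n) [take_poly n G](_ : _ = 0) ?add0r //.
  apply/polyP => i; rewrite coef_take_poly coef0; case: ltnP => // lt.
  by apply/eqP/negPn/negP => /min; rewrite leqNgt lt.
rewrite rmorphM rmorphXn eval2X exprMn -exprM mulrCA exprSr.
rewrite dvdp_mul2l ?expf_neq0 ?polyX_eq0 //.
rewrite coefMXn ltnn subnn dvdX_horner0 hornerM horner_exp => /eqP; rewrite mulrC.
rewrite [X in _ * X = _ -> _](_ : _ = ((drop_poly n G)`_0).[a.[0]]) //.
elim/poly_ind: (drop_poly n G) => [|p c _]; first by rewrite rmorph0 coef0 !horner0.
rewrite rmorphD rmorphM eval2X [eval2 _ _ c%:P]eval2E map_polyC hornerC.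
rewrite coefD coefMX add0r coefC hornerD !hornerM hornerXn horner_comp.
by rewrite expr0n -[m == 0%N]negbK -lt0n m0 mul0r mulr0 add0r.
Qed.

End TruncatedSeries.

Section ArcTangent.
Variables (C : fieldType) (F : mpoly.mpoly 3 C) (d : nat).
Hypothesis homF : F \is mpoly.ishomog1 d mpoly.mdeg.
Variables e1 e2 e3 : 'rV[C]_3.

Definition basis_point (A : comNzRingType) (f : {rmorphism C -> A}) (x y w : A) : 'rV[A]_3 :=
  x *: map_mx f e1 + y *: map_mx f e2 + w *: map_mx f e3.
Local Notation polC := (@polyC C).

Lemma map_basis_point (A B : comNzRingType) (f : {rmorphism C -> A}) (g : {rmorphism C -> B})
  (phi : {rmorphism A -> B}) x y w : phi \o f =1 g ->
  map_mx phi (basis_point f x y w) = basis_point g (phi x) (phi y) (phi w).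
Proof.
by move=> fg; apply/rowP => i; rewrite !mxE !rmorphD !rmorphM /= -!fg.
Qed.

(* Coordinates of the coefficients of an arc with centre (u : v : 1) and leading
   term of order m, whose direction has slope t. *)
Variables (x y w : nat -> C) (m : nat).
Hypothesis m0 : (0 < m)%N.
Hypothesis w0 : w 0%N != 0.
Variables u v t : C.
Hypothesis low : forall n, (n < m)%N -> x n = u * w n /\ y n = v * w n.
Hypothesis xm : x m - u * w m != 0.
Hypothesis tE : y m - v * w m = t * (x m - u * w m).
Hypothesis arc0 : forall N,
  'X^N %| feval F polC (basis_point polC (\poly_(n < N) x n) (\poly_(n < N) y n)
                                 (\poly_(n < N) w n)).

Lemma feval_modXn N x1 y1 w1 x2 y2 w2 : 'X^N %| x1 - x2 -> 'X^N %| y1 - y2 ->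
  'X^N %| w1 - w2 ->
  'X^N %| feval F polC (basis_point polC x1 y1 w1) - feval F polC (basis_point polC x2 y2 w2).
Proof.
move=> hx hy hw; have [//|//|//|S ST] := @subringClosed_of {poly C} (fun _ => True).
have ST' p : p \in S by apply/ST.
apply: (feval_cong (S := S) (I := [pred p | 'X^N %| p])) => //=.
- by move=> a b; rewrite !inE; exact: dvdp_add.
- by move=> a b _; rewrite !inE; exact: dvdp_mull.
- by rewrite inE dvdp0.
move=> i; rewrite inE !mxE.
rewrite (_ : _ - _ = (x1 - x2) * (e1 0 i)%:P + (y1 - y2) * (e2 0 i)%:P
  + (w1 - w2) * (e3 0 i)%:P); last by ring.
by rewrite !dvdp_add // dvdp_mulr.
Qed.

(** The arc in affine coordinates and in the chart of the blow-up of its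
    centre: the ratio of the displacements in the two directions is a
    series th, whose constant term is the slope of the tangent. *)
Lemma arc_blowup N : exists z th : {poly C},
  [/\ z.[0] != 0, th.[0] = t &
    'X^N %| feval F polC (basis_point polC (u%:P + 'X^m * z) (v%:P + 'X^m * z * th) 1)].
Proof.
pose N' := (N + m.+1)%N.
pose X := \poly_(n < N') x n; pose Y := \poly_(n < N') y n.
pose W := \poly_(n < N') w n.
pose a := \poly_(n < N.+1) (x (n + m)%N - u * w (n + m)%N).
pose b := \poly_(n < N.+1) (y (n + m)%N - v * w (n + m)%N).
have mN : (m < N')%N by rewrite /N' addnS ltnS leq_addl.
have aE : X - u *: W = 'X^m * a.
  apply/polyP => i; rewrite coefB coefZ coefXnM !coef_poly.
  have [lt|ge] := ltnP i m.
    by rewrite (ltn_trans lt mN); have [-> _] := low lt; rewrite subrr.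
  rewrite subnK // (_ : (i - m < N.+1)%N = (i < N')%N); last first.
    by rewrite -(ltn_add2r m) subnK // addSnnS.
  by case: ifP; rewrite ?mulr0 ?subrr.
have bE : Y - v *: W = 'X^m * b.
  apply/polyP => i; rewrite coefB coefZ coefXnM !coef_poly.
  have [lt|ge] := ltnP i m.
    by rewrite (ltn_trans lt mN); have [_ ->] := low lt; rewrite subrr.
  rewrite subnK // (_ : (i - m < N.+1)%N = (i < N')%N); last first.
    by rewrite -(ltn_add2r m) subnK // addSnnS.
  by case: ifP; rewrite ?mulr0 ?subrr.
have W0 : W.[0] = w 0%N by rewrite horner_coef0 coef_poly (leq_ltn_trans _ mN).
have a0 : a.[0] = x m - u * w m by rewrite horner_coef0 coef_poly /= add0n.
have b0 : b.[0] = y m - v * w m by rewrite horner_coef0 coef_poly /= add0n.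
(* om and xi stand for the inverses of w(t) and of (x(t) - u w(t)) / t^m. *)
have [|om omE] := @truncated_inverse C N.+1 W; first by rewrite W0.
have [|xi xiE] := @truncated_inverse C N.+1 a; first by rewrite a0.
have at0 (p q : {poly C}) : 'X^(N.+1) %| q * p - 1 -> q.[0] * p.[0] = 1.
  move=> h; have : 'X %| q * p - 1 by apply: dvdp_trans h; rewrite exprS dvdp_mulr.
  by rewrite dvdX_horner0 !hornerE subr_eq0 => /eqP.
have weak (p : {poly C}) : 'X^(N.+1) %| p -> 'X^N %| p.
  by apply: dvdp_trans; rewrite exprS dvdp_mull.
exists (om * a), (xi * b); split.
- rewrite hornerM mulf_neq0 //; last by rewrite a0.
  by apply/eqP => o0; have /eqP := at0 _ _ omE; rewrite o0 mul0r eq_sym oner_eq0.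
- have := at0 _ _ xiE; rewrite hornerM a0 => /(canRL (mulfK xm)) ->.
  by rewrite b0 tE mul1r mulrCA mulVf ?mulr1.
have h0 : 'X^N %| feval F polC (basis_point polC (om * X) (om * Y) (om * W)).
  have -> : basis_point polC (om * X) (om * Y) (om * W) = om *: basis_point polC X Y W.
    by rewrite !scalerDr !scalerA.
  rewrite (fevalZ homF) dvdp_mull //.
  by apply: dvdp_trans (arc0 N'); rewrite dvdp_exp2l // leq_addr.
rewrite -[feval _ _ _](subrK (feval F polC (basis_point polC (om * X) (om * Y) (om * W)))).
rewrite dvdp_add //; apply: feval_modXn; rewrite -dvdpNr opprB.
- have -> : om * X - (u%:P + 'X^m * (om * a)) = u%:P * (om * W - 1).
    rewrite -[X](subrK (u *: W)) aE -mul_polyC; ring.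
  by rewrite dvdp_mull // weak.
- have -> : om * Y - (v%:P + 'X^m * (om * a) * (xi * b)) =
     v%:P * (om * W - 1) - ('X^m * om * b) * (xi * a - 1).
    rewrite -[Y](subrK (v *: W)) bE -mul_polyC; ring.
  by rewrite dvdp_sub // dvdp_mull // weak.
- exact: weak.
Qed.

Let pC2 : {rmorphism C -> {poly {poly C}}} := polyC \o polC.

Lemma eval2_feval a b x1 y1 w1 :
  eval2 a b (feval F pC2 (basis_point pC2 x1 y1 w1)) =
  feval F polC (basis_point polC (eval2 a b x1) (eval2 a b y1) (eval2 a b w1)).
Proof.
have h : eval2 a b \o pC2 =1 polC by move=> c; exact: eval2C.
apply: (etrans (@feval_rmorph C F _ _ (eval2 a b) pC2 polC _ h)).
congr feval.
exact: (@map_basis_point _ _ pC2 polC (eval2 a b) _ _ _ h).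
Qed.

(** The lowest coefficient in Z of F(u + Z, v + Z T, 1) is the tangent cone of
    the curve at (u, v), written in the slope T. It is a nonzero
    polynomial over E and vanishes at the slope of every branch of finite
    slope. *)
Lemma tangent_slope_algebraic (E : divringClosed C) :
  alg_closed_in E -> (forall n, mpoly.mcoeff n F \in E) ->
  (forall i, e1 0 i \in E) -> (forall i, e2 0 i \in E) ->
  (forall i, e3 0 i \in E) -> u \in E -> v \in E ->
  feval F idfun e1 != 0 -> t \in E.
Proof.
move=> aE FE e1E e2E e3E uE vE Fe1.
pose G := feval F pC2 (basis_point pC2 (u%:P%:P + 'X) (v%:P%:P + 'X * ('X%:P)) 1).
(* For T = 0, G is the restriction of F to a line in the direction e1. *)
have G0 : G != 0.
  apply: contraTneq (line_poly_lead homF (u *: e1 + v *: e2 + e3) Fe1).1.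
  move=> G0; rewrite negbK; apply/eqP.
  rewrite -(rmorph0 (map_poly (horner_eval 0))) -G0.
  rewrite (feval_rmorph _ (g := polC)); last first.
    by move=> c /=; rewrite map_polyC /= /horner_eval hornerC.
  rewrite (map_basis_point _ _ _ (g := polC)); last first.
    by move=> c /=; rewrite map_polyC /= /horner_eval hornerC.
  congr feval; rewrite !rmorphD !rmorphM /= !map_polyC !map_polyX ?rmorph1 /=.
  rewrite /horner_eval !hornerC hornerX.
  by apply/rowP => i; rewrite !mxE !(polyCD, polyCM) ?polyC0 ?polyC1; ring.
have GE : G \is a polyOver (polyOver E).
  pose S1 := GRing.SubringClosed.clone _ (polyOver_pred E) _.
  pose S := GRing.SubringClosed.clone _ (polyOver_pred S1) _.
  apply: (feval_mem (S := S)) => [n|i]; first by rewrite !polyOverC.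
  rewrite !mxE !(rpredD, rpredM) ?polyOverX ?polyOverC ?rpred1 //= ?polyOverX ?polyOverC //.
have [n [Gn Gdvd]] := eval2_lowest G0.
have [z [th [z0 tht dv]]] := arc_blowup (m * n).+1.
have := Gdvd m th z m0; rewrite tht eval2_feval.
rewrite !rmorphD !rmorphM !eval2C !eval2X eval2Xi rmorph1 => /(_ dv)/eqP.
rewrite mulf_eq0 expf_eq0 (negbTE z0) andbF /= => Gt.
by apply: (aE _ _ _ Gn Gt); exact: (polyOverP GE).
Qed.

(** Write F(u', al u' + be + Y, 1) = Y^n H(u', Y), where H(u', 0) is a nonzero
    polynomial over K. It does not vanish at u, which is transcendental
    over K, so near the centre the curve is the line Y = 0 and every
    branch is tangent to it. *)
Lemma tangent_slope_of_line (K : divringClosed C) al be :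
  alg_closed_in K -> (forall n, mpoly.mcoeff n F \in K) ->
  (forall i, e1 0 i \in K) -> (forall i, e2 0 i \in K) ->
  (forall i, e3 0 i \in K) -> u \notin K -> al \in K -> be \in K ->
  v = al * u + be ->
  feval F idfun e2 != 0 -> t = al.
Proof.
move=> aK FK e1K e2K e3K uK alK beK vE Fe2.
pose G := feval F pC2 (basis_point pC2 ('X%:P) (al%:P%:P * ('X%:P) + be%:P%:P + 'X) 1).
(* For u' = 0, G is the restriction of F to a line in the direction e2. *)
have G0 : G != 0.
  apply: contraTneq (line_poly_lead homF (be *: e2 + e3) Fe2).1.
  move=> G0; rewrite negbK; apply/eqP.
  rewrite -(rmorph0 (map_poly (horner_eval 0))) -G0.
  rewrite (feval_rmorph _ (g := polC)); last first.
    by move=> c /=; rewrite map_polyC /= /horner_eval hornerC.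
  rewrite (map_basis_point _ _ _ (g := polC)); last first.
    by move=> c /=; rewrite map_polyC /= /horner_eval hornerC.
  congr feval; rewrite !rmorphD !rmorphM /= !map_polyC !map_polyX ?rmorph1 /=.
  rewrite /horner_eval !hornerC hornerX.
  by apply/rowP => i; rewrite !mxE !(polyCD, polyCM) ?polyC0 ?polyC1; ring.
have GK : G \is a polyOver (polyOver K).
  pose S1 := GRing.SubringClosed.clone _ (polyOver_pred K) _.
  pose S := GRing.SubringClosed.clone _ (polyOver_pred S1) _.
  apply: (feval_mem (S := S)) => [n|i]; first by rewrite !polyOverC.
  rewrite !mxE !(rpredD, rpredM) ?polyOverX ?polyOverC ?rpred1 //= ?polyOverX ?polyOverC //.
have [n [Gn Gdvd]] := eval2_lowest G0.
have [z [th [z0 tht dv]]] := arc_blowup (m * n).+1.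
have := Gdvd m (u%:P + 'X^m * z) (z * (th - al%:P)) m0.
rewrite eval2_feval.
rewrite !rmorphD !rmorphM !eval2C !eval2X eval2Xi rmorph1.
have -> : al%:P * (u%:P + 'X^m * z) + be%:P + 'X^m * (z * (th - al%:P)) =
    v%:P + 'X^m * z * th.
  by rewrite vE polyCD polyCM; ring.
move=> /(_ dv)/eqP; rewrite !hornerE tht (hornerXn, expr0n) -[m == 0%N]negbK -lt0n m0.
rewrite mul0r addr0 mulf_eq0 => /orP[|/(aK _ _ (polyOverP GK n) Gn)]; last first.
  by rewrite (negbTE uK).
rewrite expf_eq0 => /andP[_]; rewrite mulf_eq0 (negbTE z0) subr_eq0.
by move/eqP.
Qed.

End ArcTangent.

(** * Isotropic coordinates *)

Section IsotropicCoordinates.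
Variable C : numClosedFieldType.

Definition ucoord (P : 'rV[C]_3) := P 0 0 + 'i * P 0 1.
Definition vcoord (P : 'rV[C]_3) := P 0 0 - 'i * P 0 1.
Definition wcoord (P : 'rV[C]_3) := P 0 (2%:R : 'I_3).

(** The coordinates are computed over an abstract field, where reduction does
    not enter the construction of the complex numbers. *)
Definition vec (x y z : C) : 'rV[C]_3 := \row_(j < 3) [:: x; y; z]`_j.
Definition u_axis := vec (2^-1) (- 'i / 2) 0.
Definition v_axis := vec (2^-1) ('i / 2) 0.
Definition w_axis := vec 0 0 1.

Lemma rowP3 (P Q : 'rV[C]_3) : P 0 0 = Q 0 0 -> P 0 1 = Q 0 1 ->
  wcoord P = wcoord Q -> P = Q.
Proof.
move=> h0 h1 h2; apply/rowP => -[[|[|[|//]]] Hi].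
- by rewrite (_ : Ordinal Hi = 0) //; apply/val_inj.
- by rewrite (_ : Ordinal Hi = 1) //; apply/val_inj.
- by rewrite (_ : Ordinal Hi = 2%:R) //; apply/val_inj.
Qed.

Lemma isotropic_decomposition P :
  P = ucoord P *: u_axis + vcoord P *: v_axis + wcoord P *: w_axis.
Proof.
have i2 : 'i * 'i = -1 :> C by rewrite -expr2 sqrCi.
apply: rowP3; rewrite /ucoord /vcoord /wcoord !mxE /=; [by field| |by ring].
have -> : (P 0 0 + 'i * P 0 1) * (- 'i / 2) + (P 0 0 - 'i * P 0 1) * ('i / 2)
  + P 0 2%R * 0 = - ('i * 'i) * P 0 1 by field.
by rewrite i2 opprK mul1r.
Qed.

Lemma isotropic_ext P Q : ucoord P = ucoord Q -> vcoord P = vcoord Q ->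
  wcoord P = wcoord Q -> P = Q.
Proof.
by move=> h1 h2 h3; rewrite [P]isotropic_decomposition h1 h2 h3 -isotropic_decomposition.
Qed.

Lemma ucoordZ c P : ucoord (c *: P) = c * ucoord P.
Proof. by rewrite /ucoord !mxE; ring. Qed.
Lemma vcoordZ c P : vcoord (c *: P) = c * vcoord P.
Proof. by rewrite /vcoord !mxE; ring. Qed.
Lemma wcoordZ c P : wcoord (c *: P) = c * wcoord P.
Proof. by rewrite /wcoord !mxE; ring. Qed.
Lemma ucoordD P Q : ucoord (P + Q) = ucoord P + ucoord Q.
Proof. by rewrite /ucoord !mxE; ring. Qed.
Lemma vcoordD P Q : vcoord (P + Q) = vcoord P + vcoord Q.
Proof. by rewrite /vcoord !mxE; ring. Qed.
Lemma wcoordD P Q : wcoord (P + Q) = wcoord P + wcoord Q.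
Proof. by rewrite /wcoord !mxE; ring. Qed.

(** With vdir, the homogeneous direction of the line from the affine point A
    to P. It is linear in P, so P may be at infinity. *)
Definition udir A P := wcoord A * ucoord P - wcoord P * ucoord A.
Definition vdir A P := wcoord A * vcoord P - wcoord P * vcoord A.

Lemma udirZl c A P : udir (c *: A) P = c * udir A P.
Proof. by rewrite /udir wcoordZ ucoordZ; ring. Qed.
Lemma vdirZl c A P : vdir (c *: A) P = c * vdir A P.
Proof. by rewrite /vdir wcoordZ vcoordZ; ring. Qed.
Lemma udirZ c A P : udir A (c *: P) = c * udir A P.
Proof. by rewrite /udir wcoordZ ucoordZ; ring. Qed.
Lemma vdirZ c A P : vdir A (c *: P) = c * vdir A P.
Proof. by rewrite /vdir wcoordZ vcoordZ; ring. Qed.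
Lemma udirN A P : udir A P = - udir P A.
Proof. by rewrite /udir; ring. Qed.
Lemma vdirN A P : vdir A P = - vdir P A.
Proof. by rewrite /vdir; ring. Qed.

Lemma dir0_prop A P : wcoord A != 0 -> udir A P = 0 -> vdir A P = 0 ->
  P = (wcoord P / wcoord A) *: A.
Proof.
move=> A0 /eqP; rewrite subr_eq0 => /eqP hu /eqP; rewrite subr_eq0 => /eqP hv.
apply: isotropic_ext; rewrite ?ucoordZ ?vcoordZ ?wcoordZ; apply: (mulfI A0).
- by rewrite hu; field.
- by rewrite hv; field.
- by field.
Qed.

Lemma sub_col_mxP (u v p : 'rV[C]_3) :
  (p <= col_mx u v)%MS <-> exists a b, p = a *: u + b *: v.
Proof.
split.
  move=> /submxP[D ->]; rewrite -[D]hsubmxK mul_row_col.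
  exists (lsubmx D 0 0), (rsubmx D 0 0).
  by rewrite [lsubmx D]mx11_scalar [rsubmx D]mx11_scalar !mul_scalar_mx !mxE.
move=> [a [b ->]]; apply/submxP; exists (row_mx a%:M b%:M).
by rewrite mul_row_col !mul_scalar_mx.
Qed.

Lemma on_lineP A B P : wcoord A != 0 -> (udir A B != 0) || (vdir A B != 0) ->
  (P <= col_mx A B)%MS <-> udir A P * vdir A B = vdir A P * udir A B.
Proof.
move=> A0 AB; rewrite sub_col_mxP; split=> [[a [b ->]]|e].
  by rewrite /udir /vdir !(ucoordD, vcoordD, wcoordD, ucoordZ, vcoordZ, wcoordZ); ring.
suff [b [hu hv]] : exists b, udir A (P - b *: B) = 0 /\ vdir A (P - b *: B) = 0.
  have E := dir0_prop A0 hu hv.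
  exists (wcoord (P - b *: B) / wcoord A), b.
  by rewrite -E subrK.
have dB b : udir A (P - b *: B) = udir A P - b * udir A B /\
            vdir A (P - b *: B) = vdir A P - b * vdir A B.
  by rewrite -scaleNr /udir /vdir !(ucoordD, vcoordD, wcoordD, ucoordZ, vcoordZ, wcoordZ); split; ring.
case/orP: AB => d0.
  exists (udir A P / udir A B); rewrite !(dB _).1 !(dB _).2; split.
    by rewrite divfK // subrr.
  by apply: (mulIf d0); rewrite mul0r mulrBl -e; field.
exists (vdir A P / vdir A B); rewrite !(dB _).1 !(dB _).2; split.
  by apply: (mulIf d0); rewrite mul0r mulrBl e; field.
by rewrite divfK // subrr.
Qed.

End IsotropicCoordinates.

Section AxisCoordinates.
Variable C : numClosedFieldType.
Let i2 : 'i * 'i = -1 :> C. Proof. by rewrite -expr2 sqrCi. Qed.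

Lemma u_axisE : [/\ ucoord (u_axis C) = 1, vcoord (u_axis C) = 0 & wcoord (u_axis C) = 0].
Proof.
rewrite /ucoord /vcoord /wcoord !mxE /=; split=> //; first by field: i2.
by field: i2.
Qed.

Lemma v_axisE : [/\ ucoord (v_axis C) = 0, vcoord (v_axis C) = 1 & wcoord (v_axis C) = 0].
Proof.
rewrite /ucoord /vcoord /wcoord !mxE /=; split=> //; first by field: i2.
by field: i2.
Qed.

Lemma w_axisE : [/\ ucoord (w_axis C) = 0, vcoord (w_axis C) = 0 & wcoord (w_axis C) = 1].
Proof.
by rewrite /ucoord /vcoord /wcoord !mxE /=; split=> //; ring.
Qed.

Lemma axis_norm_le1 i :
  [/\ `|u_axis C 0 i| <= 1, `|v_axis C 0 i| <= 1 & `|w_axis C 0 i| <= 1].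
Proof.
have h2 : `|2^-1 : C| <= 1 by rewrite ger0_norm ?invr_ge0 ?ler0n // invf_le1 ?ltr0n // ler1n.
by split; rewrite mxE; case: i => [[|[|[|//]]] iP] /=;
  rewrite ?normrM ?normrN ?normCi ?mul1r ?normr0 ?normr1 ?ler01.
Qed.

Lemma uw_coord_shift (P B : 'rV[C]_3) a x :
  ucoord (P + a *: B + x *: v_axis C) = ucoord P + a * ucoord B /\
  wcoord (P + a *: B + x *: v_axis C) = wcoord P + a * wcoord B.
Proof.
have [ub _ wb] := v_axisE.
by rewrite !(ucoordD, wcoordD, ucoordZ, wcoordZ) ub wb !mulr0 !addr0.
Qed.

Lemma shift_entry (P B D : 'rV[C]_3) a x i :
  P 0 i - (P + a *: B + x *: D) 0 i = - (a * B 0 i + x * D 0 i).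
Proof. by rewrite !mxE; ring. Qed.

Lemma v_axis_prop (P : 'rV[C]_3) : ucoord P = 0 -> wcoord P = 0 ->
  P = vcoord P *: v_axis C.
Proof.
by move=> u0 w0; rewrite [LHS]isotropic_decomposition u0 w0 !scale0r add0r addr0.
Qed.

Lemma basis_point_truncation (f : nat -> 'rV[C]_3) N i :
  (basis_point (u_axis C) (v_axis C) (w_axis C) (@polyC C) (\poly_(n < N) ucoord (f n))
    (\poly_(n < N) vcoord (f n)) (\poly_(n < N) wcoord (f n))) 0 i =
  \poly_(n < N) f n 0 i.
Proof.
rewrite /basis_point; move: (u_axis C) (v_axis C) (w_axis C) (@isotropic_decomposition C).
move=> eu ev ew dec; apply/polyP => j; rewrite !mxE !coefD !coefMC !coef_poly.
case: ltnP => _; last by rewrite !mul0r !addr0.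
by rewrite [in RHS](dec (f j)) !mxE.
Qed.

Lemma vec_isotropic (y : C) : vec 1 y 0 = 2 *: vec 2^-1 (y / 2) 0 /\ vec 1 y 0 != 0.
Proof.
split; first by apply: rowP3; rewrite /wcoord !mxE /=; field.
by apply/eqP => /rowP /(_ 0); rewrite !mxE /=; exact/eqP/oner_neq0.
Qed.

End AxisCoordinates.

(** * Points, lines and reflections in the projective plane *)

Section Points.
Local Open Scope quotient_scope.
Variable R : realType.
Local Notation C := (Cplx R).
Implicit Types (p q : CP2 R) (P Q : 'rV[C]_3).

Lemma coords_neq0 p : coords p != 0.
Proof. exact: (valP (repr p)). Qed.

Lemma hpointP P : P != 0 -> exists2 c, c != 0 & coords (hpoint P) = c *: P.
Proof.
move=> P0; rewrite /hpoint; set x := insubd _ _.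
have xP : nzval x = P by rewrite /nzval /x /insubd insubT /=.
have : proportional (repr (\pi_(CP2 R) x)) x by apply/eqmodP; rewrite reprK.
rewrite /proportional xP -/(coords _) => /andP[/sub_rVP[c E] _].
exists c => //; apply: contraTneq (coords_neq0 (\pi_(CP2 R) x)) => c0.
by rewrite E c0 scale0r eqxx.
Qed.

Lemma coords_inj p q c : coords p = c *: coords q -> p = q.
Proof.
move=> E; rewrite -[p]reprK -[q]reprK; apply/eqmodP.
have c0 : c != 0.
  by apply: contraTneq (coords_neq0 p) => c0; rewrite E c0 scale0r eqxx.
rewrite /= /proportional -!/(coords _) E; apply/andP; split.
  exact: scalemx_sub.
by rewrite -[X in (X <= _)%MS](scalerK c0) scalemx_sub.
Qed.

Lemma row_mx21 (z : 'rV[C]_2) (c : 'M[C]_1) :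
  (row_mx z c : 'rV[C]_3) = vec (z 0 0) (z 0 1) (c 0 0).
Proof.
apply: rowP3; rewrite /wcoord !mxE.
- case: splitP => j /= ej; last by [].
  by congr (z _ _); apply/val_inj.
- case: splitP => j /= ej; last by [].
  by congr (z _ _); apply/val_inj.
- by case: splitP => j /= ej; [case: j ej => -[|[|]]|rewrite ord1].
Qed.

Lemma ucoord_vec (x y z : C) : ucoord (vec x y z) = x + 'i * y.
Proof. by rewrite /ucoord !mxE. Qed.
Lemma vcoord_vec (x y z : C) : vcoord (vec x y z) = x - 'i * y.
Proof. by rewrite /vcoord !mxE. Qed.
Lemma wcoord_vec (x y z : C) : wcoord (vec x y z) = z.
Proof. by rewrite /wcoord !mxE. Qed.

(** The lines through I1 are those with du = 0, the lines through I2 those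
    with dv = 0. *)
Lemma nonisotropic_dir (A B : 'rV[C]_3) : wcoord A != 0 ->
  (udir A B != 0) || (vdir A B != 0) ->
  ~ isotropic (span_line A B : set (CP2 R)) -> udir A B != 0 /\ vdir A B != 0.
Proof.
move=> A0 AB nI; have i2 : 'i * 'i = -1 :> C by rewrite -expr2 sqrCi.
have v0 y : vec 1 y 0 != 0 :> 'rV[C]_3.
  by apply/eqP => /rowP /(_ 0); rewrite !mxE /=; exact/eqP/oner_neq0.
split; apply/eqP => d0; apply: nI; [left|right].
  rewrite /span_line /=; have [c c0 ->] := hpointP (v0 'i).
  apply/on_lineP => //; rewrite d0 mulr0 /udir ucoordZ wcoordZ.
  by rewrite ucoord_vec wcoord_vec i2 subrr !(mulr0, mul0r) subrr mul0r.
rewrite /span_line /=; have [c c0 ->] := hpointP (v0 (- 'i)).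
apply/on_lineP => //; rewrite d0 mulr0 /vdir vcoordZ wcoordZ.
by rewrite vcoord_vec wcoord_vec mulrN opprK i2 subrr !(mulr0, mul0r) subrr mul0r.
Qed.

Lemma mul_affine_ext (P : 'rV[C]_3) (U : 'M[C]_2) b :
  P *m affine_ext U b =
    vec (P 0 0 * U 0 0 + P 0 1 * U 1 0 + wcoord P * b 0 0)
        (P 0 0 * U 0 1 + P 0 1 * U 1 1 + wcoord P * b 0 1) (wcoord P).
Proof.
pose z : 'rV[C]_2 := \row_(j < 2) [:: P 0 0; P 0 1]`_j.
have E : P = row_mx z (wcoord P)%:M :> 'rV[C]_3.
  by rewrite row_mx21 !mxE; apply: rowP3; rewrite /wcoord !mxE.
rewrite {1}E; apply: (etrans (@mul_row_block C 1 2 1 2 1 z _ U 0 b 1%:M)).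
rewrite mulmx0 add0r mulmx1 row_mx21.
rewrite !mxE /= !big_ord_recl !big_ord0 !mxE /= !addr0 mulr1n.
by rewrite (_ : lift ord0 ord0 = 1) //; apply/val_inj.
Qed.

Lemma chart_coords (z : 'rV[C]_2) :
  exists2 c, c != 0 & coords (chart z : CP2 R) = c *: vec (z 0 0) (z 0 1) 1.
Proof.
rewrite /chart row_mx21 mxE eqxx; apply: hpointP.
by apply/eqP => /rowP /(_ 2%R); rewrite !mxE /=; exact/eqP/oner_neq0.
Qed.

(** An isometry of du dv is diagonal or antidiagonal in the coordinates (u,
    v). The linear part of the symmetry fixes the direction of T, which
    has two nonzero components. If it were diagonal it would be the
    identity; so it is antidiagonal, and it is determined by t. *)
Lemma reflection_matrix (T : set (CP2 R)) U b (A : 'rV[C]_3) (B : 'rV[C]_3) :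
    wcoord A != 0 -> udir A B != 0 -> vdir A B != 0 ->
    T = span_line A B -> is_symmetry T U b ->
  let t := vdir A B / udir A B in
  forall P : 'rV[C]_3,
    udir A (P *m affine_ext U b) = t^-1 * vdir A P /\
    vdir A (P *m affine_ext U b) = t * udir A P.
Proof.
move=> A0 p0 q0 -> [Uq finv fid fix_] t P.
have i2 : 'i * 'i = -1 :> C by rewrite -expr2 sqrCi.
have i0 : 'i != 0 :> C by exact: neq0Ci.
have AB : (udir A B != 0) || (vdir A B != 0) by rewrite p0.
set p := udir A B in p0 t AB *; set q := vdir A B in q0 t AB *.
pose z2 x y : 'rV[C]_2 := \row_(j < 2) [:: x; y]`_j.
(* the fixed points of the symmetry: A itself and its translates along AB *)
have fixT s : z2 (A 0 0 / wcoord A + s * ((p + q) / 2))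
                 (A 0 1 / wcoord A + s * ((p - q) / (2 * 'i))) *m U + b =
              z2 (A 0 0 / wcoord A + s * ((p + q) / 2))
                 (A 0 1 / wcoord A + s * ((p - q) / (2 * 'i))).
  apply: fix_; rewrite /span_line /=.
  set z := z2 _ _; have [c c0 ->] := chart_coords z.
  apply/on_lineP => //; rewrite udirZ vdirZ -/p -/q -!mulrA; congr (_ * _).
  rewrite /udir /vdir wcoord_vec ucoord_vec vcoord_vec !mxE /= /ucoord /vcoord.
  by field; rewrite A0 i0.
have fixA : (z2 (A 0 0 / wcoord A) (A 0 1 / wcoord A)) *m U + b =
            z2 (A 0 0 / wcoord A) (A 0 1 / wcoord A).
  by have := fixT 0; rewrite !mul0r !addr0.
have fixB := fixT 1; rewrite !mul1r in fixB.
have UE (z : 'rV[C]_2) : z *m U =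
    z2 (z 0 0 * U 0 0 + z 0 1 * U 1 0) (z 0 0 * U 0 1 + z 0 1 * U 1 1).
  apply/rowP => j; rewrite !mxE !big_ord_recl big_ord0 addr0.
  rewrite (_ : lift ord0 ord0 = 1); last exact/val_inj.
  by case: j => [[|[|//]] jP] /=; congr (_ * U _ _ + _ * U _ _); apply/val_inj.
have z2E x1 x2 y1 y2 : z2 x1 x2 = z2 y1 y2 -> x1 = y1 /\ x2 = y2.
  by move=> /rowP E; have := E 0; have := E 1; rewrite !mxE.
set x := U 0 0 in UE; set y := U 0 1 in UE; set x' := U 1 0 in UE;
  set y' := U 1 1 in UE.
(* al, be, ga, ep are the entries of U in the basis of the two isotropic
   directions. *)
pose al := (x + y' - 'i * x' + 'i * y) / 2.
pose be := (x - y' - 'i * x' - 'i * y) / 2.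
pose ga := (x - y' + 'i * x' + 'i * y) / 2.
pose ep := (x + y' + 'i * x' - 'i * y) / 2.
have Lu a1 a2 : (a1 * x + a2 * x') + 'i * (a1 * y + a2 * y') =
    (a1 + 'i * a2) * al + (a1 - 'i * a2) * ga.
  by rewrite /al /ga; field: i2.
have Lv a1 a2 : (a1 * x + a2 * x') - 'i * (a1 * y + a2 * y') =
    (a1 + 'i * a2) * be + (a1 - 'i * a2) * ep.
  by rewrite /be /ep; field: i2.
have hq s r : (s * al + r * ga) * (s * be + r * ep) = s * r.
  have := Uq (z2 ((s + r) / 2) (- 'i * (s - r) / 2)).
  rewrite UE /qform !mxE /= => E.
  have e1 : (s + r) / 2 + 'i * (- 'i * (s - r) / 2) = s by field: i2.
  have e2 : (s + r) / 2 - 'i * (- 'i * (s - r) / 2) = r by field: i2.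
  have := Lu ((s + r) / 2) (- 'i * (s - r) / 2); rewrite e1 e2 => <-.
  have := Lv ((s + r) / 2) (- 'i * (s - r) / 2); rewrite e1 e2 => <-.
  rewrite mulrC -subr_sqr exprMn sqrCi mulN1r opprK E.
  by field: i2.
have [fA0 fA1] : (A 0 0 / wcoord A) * x + (A 0 1 / wcoord A) * x' + b 0 0 = A 0 0 / wcoord A
   /\ (A 0 0 / wcoord A) * y + (A 0 1 / wcoord A) * y' + b 0 1 = A 0 1 / wcoord A.
  by move: fixA => /rowP E; have := E 0; have := E 1; rewrite UE !mxE /=.
have [fB0 fB1] : (p + q) / 2 * x + (p - q) / (2 * 'i) * x' = (p + q) / 2 /\
   (p + q) / 2 * y + (p - q) / (2 * 'i) * y' = (p - q) / (2 * 'i).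
  move: fixB => /rowP E; have := E 0; have := E 1; rewrite UE !mxE /= => E1 E0.
  set d0 := (p + q) / 2 in E0 E1 *; set d1 := (p - q) / (2 * 'i) in E0 E1 *.
  split.
    transitivity ((A 0 0 / wcoord A + d0) * x + (A 0 1 / wcoord A + d1) * x' + b 0 0
      - (A 0 0 / wcoord A * x + A 0 1 / wcoord A * x' + b 0 0)); first by ring.
    by rewrite E0 fA0; ring.
  transitivity ((A 0 0 / wcoord A + d0) * y + (A 0 1 / wcoord A + d1) * y' + b 0 1
      - (A 0 0 / wcoord A * y + A 0 1 / wcoord A * y' + b 0 1)); first by ring.
  by rewrite E1 fA1; ring.
have e1 : (p + q) / 2 + 'i * ((p - q) / (2 * 'i)) = p by field.
have e2 : (p + q) / 2 - 'i * ((p - q) / (2 * 'i)) = q by field.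
have pE : p * al + q * ga = p.
  by have := Lu ((p + q) / 2) ((p - q) / (2 * 'i)); rewrite fB0 fB1 e1 e2.
have qE : p * be + q * ep = q.
  by have := Lv ((p + q) / 2) ((p - q) / (2 * 'i)); rewrite fB0 fB1 e1 e2.
have albe : al * be = 0 by have := hq 1 0; rewrite !mul1r !mul0r !addr0.
have gaep : ga * ep = 0 by have := hq 0 1; rewrite !mul1r !mul0r !add0r.
have al0 : al = 0.
  have [//|al0] := eqVneq al 0; exfalso.
  have be0 : be = 0 by move/eqP: albe; rewrite mulf_eq0 (negbTE al0) => /eqP.
  have ep1 : ep = 1 by move: qE; rewrite be0 mulr0 add0r => /(canRL (mulKf q0)) ->; rewrite mulVf.
  have ga0 : ga = 0 by move: gaep; rewrite ep1 mulr1.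
  have al1 : al = 1 by move: pE; rewrite ga0 mulr0 addr0 => /(canRL (mulKf p0)) ->; rewrite mulVf.
  have U1 a1 a2 : a1 * x + a2 * x' = a1 /\ a1 * y + a2 * y' = a2.
    have := Lu a1 a2; have := Lv a1 a2; rewrite be0 ep1 ga0 al1 !mulr0 !mulr1 add0r addr0.
    set X := _ + _ * x'; set Y := _ + _ * y' => hv hu.
    have hX : X = a1.
      apply: (mulfI (_ : 2 != 0)); first by rewrite pnatr_eq0.
      have -> : 2 * X = (X + 'i * Y) + (X - 'i * Y) by ring.
      by rewrite hu hv; ring.
    by split=> //; apply: (mulfI i0); apply: (addrI X); rewrite hu hX.
  move: fA0 fA1; rewrite !(U1 _ _).1 !(U1 _ _).2 => fA0 fA1.
  have b0 : b 0 0 = 0 by apply: (addrI (A 0 0 / wcoord A)); rewrite fA0 addr0.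
  have b1 : b 0 1 = 0 by apply: (addrI (A 0 1 / wcoord A)); rewrite fA1 addr0.
  apply: fid => z; rewrite UE !(U1 _ _).1 !(U1 _ _).2; apply/rowP => j; rewrite !mxE.
  case: j => [[|[|//]] jP] /=.
    by rewrite (_ : Ordinal jP = 0) ?b0 ?addr0 //; apply/val_inj.
  by rewrite (_ : Ordinal jP = 1) ?b1 ?addr0 //; apply/val_inj.
have gaE : ga = t^-1.
  by rewrite /t invf_div; move: pE; rewrite al0 mulr0 add0r => /(canRL (mulKf q0)) ->; rewrite mulrC.
have ga0 : ga != 0 by rewrite gaE /t invf_div mulf_neq0 // invr_eq0.
have ep0 : ep = 0 by move/eqP: gaep; rewrite mulf_eq0 (negbTE ga0) => /eqP.
have beE : be = t.
  by move: qE; rewrite ep0 mulr0 addr0 => /(canRL (mulKf p0)) ->; rewrite mulrC.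
have bu : b 0 0 = (A 0 0 / wcoord A) - ((A 0 0 / wcoord A) * x + (A 0 1 / wcoord A) * x').
  by rewrite -{1}fA0 addrC addKr.
have bv : b 0 1 = (A 0 1 / wcoord A) - ((A 0 0 / wcoord A) * y + (A 0 1 / wcoord A) * y').
  by rewrite -{1}fA1 addrC addKr.
have LPu := Lu (P 0 0) (P 0 1); have LPv := Lv (P 0 0) (P 0 1).
have LAu := Lu (A 0 0) (A 0 1); have LAv := Lv (A 0 0) (A 0 1).
rewrite mul_affine_ext /udir /vdir ucoord_vec vcoord_vec wcoord_vec -/x -/y -/x' -/y' bu bv.
rewrite -gaE -beE; split.
  transitivity (wcoord A * (P 0 0 * x + P 0 1 * x' + 'i * (P 0 0 * y + P 0 1 * y'))
    - wcoord P * (A 0 0 * x + A 0 1 * x' + 'i * (A 0 0 * y + A 0 1 * y'))).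
    by rewrite /ucoord; field.
  by rewrite LPu LAu al0 /vcoord; ring.
transitivity (wcoord A * (P 0 0 * x + P 0 1 * x' - 'i * (P 0 0 * y + P 0 1 * y'))
    - wcoord P * (A 0 0 * x + A 0 1 * x' - 'i * (A 0 0 * y + A 0 1 * y'))).
  by rewrite /vcoord; field.
by rewrite LPv LAv ep0 /ucoord; ring.
Qed.

(** The relation between the slopes, s_(j-1) s_j = t_j^2, in a form that makes
    sense when the slopes are infinite. *)
Lemma reflection_law (T : set (CP2 R)) (A B : 'rV[C]_3) (p a q : CP2 R) :
    wcoord (coords a) != 0 -> (exists2 c, c != 0 & coords a = c *: A) ->
    T = span_line A B -> udir A B != 0 -> vdir A B != 0 -> p <> a ->
    symmetric_lines T (join_line p a) (join_line a q) ->
  let t := vdir A B / udir A B in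
  exists2 c, c != 0 & udir (coords a) (coords q) = c * vdir (coords a) (coords p)
    /\ vdir (coords a) (coords q) = c * t ^+ 2 * udir (coords a) (coords p).
Proof.
move=> a0 [c1 c10 aA] TE u0 v0 pa [U [b [sym im]]] t.
have A0 : wcoord A != 0 by move: a0; rewrite aA wcoordZ mulf_eq0 negb_or => /andP[].
have t0 : t != 0 by rewrite mulf_neq0 ?invr_eq0.
have ref P : udir (coords a) (P *m affine_ext U b) = t^-1 * vdir (coords a) P /\
    vdir (coords a) (P *m affine_ext U b) = t * udir (coords a) P.
  have [hu hv] := reflection_matrix A0 u0 v0 TE sym P.
  by rewrite aA !udirZl !vdirZl hu hv -/t; split; rewrite mulrCA.
clearbody t; have [ru rv] := ref (coords p); set M := affine_ext U b in ru rv im.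
have pna : ~ (udir (coords a) (coords p) = 0 /\ vdir (coords a) (coords p) = 0).
  by move=> [h1 h2]; apply: pa; exact: coords_inj (dir0_prop a0 h1 h2).
have dir0 : udir (coords a) (0 : 'rV[C]_3) = 0 /\ vdir (coords a) (0 : 'rV[C]_3) = 0.
  by rewrite -[0 : 'rV[C]_3](scale0r 0) udirZ vdirZ !mul0r.
have PM0 : coords p *m M != 0.
  apply/eqP => E; move: ru rv; rewrite E dir0.1 dir0.2 => /esym/eqP ru /esym/eqP rv.
  apply: pna; move: ru rv; rewrite !mulf_eq0 invr_eq0 (negbTE t0) /=.
  by move=> /eqP -> /eqP ->.
have [c c0 E] := hpointP PM0.
have : join_line a q (proj_map M p).
  rewrite -im; exists p => //; rewrite /join_line /span_line /=.
  by apply/sub_col_mxP; exists 1, 0; rewrite scale1r scale0r addr0.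
rewrite /join_line /span_line /= /proj_map E => /sub_col_mxP[x [y xy]].
have hu : c * (t^-1 * vdir (coords a) (coords p)) = y * udir (coords a) (coords q).
  rewrite -ru -udirZ xy /udir !(ucoordD, wcoordD, ucoordZ, wcoordZ); ring.
have hv : c * (t * udir (coords a) (coords p)) = y * vdir (coords a) (coords q).
  rewrite -rv -vdirZ xy /vdir !(vcoordD, wcoordD, vcoordZ, wcoordZ); ring.
have y0 : y != 0.
  apply/eqP => y0; apply: pna; move: hu hv; rewrite y0 !mul0r.
  move=> /eqP hu /eqP hv; move: hu hv.
  rewrite !mulf_eq0 invr_eq0 (negbTE t0) (negbTE c0) /=.
  by move=> /eqP -> /eqP ->.
exists (c / (y * t)); first by rewrite mulf_neq0 // invr_eq0 mulf_neq0.
split; apply: (mulfI y0); rewrite -?hu -?hv; field; rewrite ?t0 ?y0 //.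
Qed.

End Points.

(** * Generic points near a given point of a curve *)

Section CountableClosure.
Variables (C : closedFieldType) (S : nat -> C).

Let roots (p : {poly C}) : seq C := sval (closed_field_poly_normal p).

Let rootsP p x : p != 0 -> root p x -> x \in roots p.
Proof.
move=> p0; rewrite /roots; case: closed_field_poly_normal => r /= E.
by rewrite {1}E rootZ ?lead_coef_eq0 // root_prod_XsubC.
Qed.

(** The values of expressions built from 1 and the S n by differences,
    quotients and extraction of roots; in the last case n - 2 is the rank
    of the root in a fixed enumeration, the labels 0 and 1 being taken by
    the field operations. *)
Fixpoint tree_value (t : GenTree.tree nat) : C :=
  match t with
  | GenTree.Leaf 0 => 1
  | GenTree.Leaf n.+1 => S n
  | GenTree.Node 0 [:: a; b] => tree_value a - tree_value b
  | GenTree.Node 1 [:: a; b] => tree_value a / tree_value b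
  | GenTree.Node n l => (roots (Poly (map tree_value l)))`_(n - 2)
  end.

(** There are countably many expressions, and their values form a field closed
    under roots of polynomials. *)
Lemma countable_alg_closed : exists (K : divringClosed C) (f : nat -> C),
  [/\ alg_closed_in K, forall n, S n \in K & forall x, x \in K -> exists n, x = f n].
Proof.
have [|x y|x y|K KP] := @divringClosed_of C (fun x => exists t, tree_value t = x).
- by exists (GenTree.Leaf 0%N).
- by move=> [a <-] [b <-]; exists (GenTree.Node 0 [:: a; b]).
- by move=> [a <-] [b <-]; exists (GenTree.Node 1 [:: a; b]).
exists K, (fun n => oapp tree_value 0 (unpickle n)); split.
- move=> p x pK p0 px; apply/KP.
  have [l lE] : exists l, map tree_value l = p.
    have {pK} : all (mem K) p := pK; elim: (p : seq C) => [_|c s IH /= /andP[/KP[t tE] /IH[l lE]]].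
      by exists [::].
    by exists (t :: l); rewrite /= tE lE.
  exists (GenTree.Node (index x (roots p)).+2 l).
  rewrite /= subn2 /= lE polyseqK nth_index //; exact: rootsP.
- by move=> n; apply/KP; exists (GenTree.Leaf n.+1).
- by move=> x /KP[t <-]; exists (pickle t); rewrite pickleK.
Qed.

End CountableClosure.

Section SmallRoots.
Variable C : numClosedFieldType.
Implicit Types p q : {poly C}.

(** The product of the absolute values of the roots is the quotient of the
    constant coefficient by the leading one. *)
Lemma exists_small_root p e : 0 <= e ->
  `|p.[0]| < `|lead_coef p| * e ^+ (size p).-1 -> exists2 x, root p x & `|x| < e.
Proof.
move=> e0 small; have [r E] := closed_field_poly_normal p.
have p0 : p != 0.
  by apply: contraTneq small => ->; rewrite horner0 lead_coef0 normr0 mul0r ltxx.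
have l0 : lead_coef p != 0 by rewrite lead_coef_eq0.
have sr : (size p).-1 = size r.
  by rewrite E size_scale // size_prod_XsubC.
have [/hasP[x xr xe]|no] := boolP (has (fun x => `|x| < e) r).
  by exists x => //; rewrite E rootZ // root_prod_XsubC.
move: small; rewrite {1}E hornerZ normrM ltr_pM2l ?normr_gt0 // sr.
rewrite horner_prod normr_prod => small; exfalso; move: small; apply/negP.
rewrite -real_leNgt ?rpredX ?ger0_real ?prodr_ge0 ?exprn_ge0 //.
elim: r no {E sr} => [|x r IH]; first by rewrite big_nil expr0.
rewrite big_cons exprS /= negb_or => /andP[xe /IH le].
rewrite ler_pM ?exprn_ge0 //; rewrite !hornerE ?sub0r ?add0r normrN.
by rewrite real_leNgt ?ger0_real.
Qed.

Lemma horner_near0 p : p.[0] = 0 -> exists2 M, 0 < M & forall a, `|a| <= 1 ->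
  `|p.[a]| <= M * `|a|.
Proof.
move=> p0; have /factor_theorem[q E] : root p 0 by apply/eqP.
exists (1 + \sum_(i < size q) `|q`_i|).
  by rewrite ltr_pwDl ?ltr01 // sumr_ge0.
move=> a a1; rewrite E hornerM !hornerE subr0 normrM ler_wpM2r //.
rewrite horner_coef (le_trans (ler_norm_sum _ _ _)) //.
rewrite -[leLHS]add0r lerD ?ler01 // ler_sum // => i _.
by rewrite normrM normrX ler_piMr // exprn_ile1.
Qed.

End SmallRoots.

(** Otherwise the interval would inject into the natural numbers and have
    measure zero. *)
Lemma interval_avoids_sequence (R : realType) (T : Type) (f : R -> T) (S : nat -> T) e :
  0 < e -> (forall r s, 0 < r -> 0 < s -> f r = f s -> r = s) ->
  exists2 r, 0 < r < e & forall n, f r <> S n.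
Proof.
move=> e0 injf; apply: contrapT => no.
have h r : 0 < r < e -> exists n, f r = S n.
  move=> re; apply: contrapT => nor; apply: no; exists r => // n fr.
  by apply: nor; exists n.
pose g r := if pselect (0 < r < e) is left p then sval (cid (h r p)) else 0%N.
have gP r : 0 < r < e -> f r = S (g r).
  by move=> re; rewrite /g; case: pselect => // p; case: cid.
have : countable (`]0, e[ : set R).
  apply/countable_injP; exists g => r s.
  rewrite !inE /= !in_itv /= => re se E; apply: injf.
  - by case/andP: re.
  - by case/andP: se.
  - by rewrite (gP r) // (gP s) // E.
move/countable_lebesgue_measure0; rewrite lebesgue_measure_itv /= lte_fin e0.
by rewrite sube0 => /eqP; rewrite eqe gt_eqF.
Qed.

Section Nearby.
Local Open Scope classical_set_scope.
Local Open Scope quotient_scope.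
Variable R : realType.
Local Notation C := (Cplx R).

(** The topology of the plane is the quotient of that of nonzero vectors, so
    neighbourhoods contain all points with nearby homogeneous coordinates. *)
Lemma open_CP2_ball (V : set (CP2 R)) p : open V -> V p ->
  exists2 e : C, 0 < e & forall P : 'rV[C]_3, P != 0 ->
    (forall i, `|coords p 0 i - P 0 i| < e) -> V (hpoint P).
Proof.
move=> oV Vp; have [W oW WE] : open (\pi_(CP2 R) @^-1` V : set (@nonzero_vector R)) := oV.
have Wp : W (coords p).
  have : (\pi_(CP2 R) @^-1` V) (repr p) by rewrite /= reprK.
  by rewrite -WE.
have /nbhs_ballP[e e0 eW] : nbhs (coords p) W by apply: open_nbhs_nbhs.
exists e => // P P0 Pe.
have : W P.
  by apply: eW; split=> // i j; rewrite (ord1 i); exact: Pe.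
rewrite /hpoint; set x := insubd _ _.
have xP : nzval x = P by rewrite /nzval /x /insubd insubT /=.
rewrite -xP => Wx; suff : (\pi_(CP2 R) @^-1` V) x by [].
by rewrite -WE.
Qed.

(** Move P0 a little by a in a direction that changes u / w, then along the
    v-axis to return to the curve. The second displacement is small
    because F restricted to the v-direction has a constant nonzero leading
    coefficient and a small value at the origin. Uncountably many a are
    available, so the sequence S can be avoided. *)
Lemma nearby_generic_point (F : mpoly.mpoly 3 C) d (P0 : 'rV[C]_3) (e : C) (S : nat -> C) :
    F \is mpoly.ishomog1 d mpoly.mdeg -> feval F idfun (v_axis C) != 0 ->
    P0 != 0 -> feval F idfun P0 = 0 -> 0 < e ->
  exists P : 'rV[C]_3, [/\ forall i, `|P0 0 i - P 0 i| < e, feval F idfun P = 0,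
    wcoord P != 0 & forall n, ucoord P / wcoord P <> S n].
Proof.
move=> homF Fv P00 F0 e0.
pose rc := real_complex R : R -> C.
have rc0 r : 0 < r -> 0 < rc r by move=> r0; rewrite -[0]/(rc 0) ltcR.
have rcI r s : rc r = rc s -> r = s by apply: complexI.
(* B is the u-axis for an affine P0. A point at infinity is moved along the
   w-axis instead; it has u nonzero because the curve avoids I1. *)
have [B [f [Bax injf fE]]] : exists B (f : R -> C),
    [/\ forall i : 'I_3, `|(B : 'rV[C]_3) 0 i| <= 1,
      (forall r s, 0 < r -> 0 < s -> f r = f s -> r = s) &
      forall r x, 0 < r -> wcoord (P0 + rc r *: B + x *: v_axis C) != 0 /\
      ucoord (P0 + rc r *: B + x *: v_axis C) / wcoord (P0 + rc r *: B + x *: v_axis C) = f r].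
  have [ua va wa] := u_axisE C; have [uc vc wc] := w_axisE C.
  have [w0|w0] := eqVneq (wcoord P0) 0.
    exists (w_axis C), (fun r => ucoord P0 / rc r).
    have u0 : ucoord P0 != 0.
      apply/eqP => u0; have E := v_axis_prop u0 w0.
      have := F0; rewrite E (fevalZ homF) => /eqP; rewrite mulf_eq0 (negbTE Fv) orbF.
      rewrite expf_eq0 => /andP[_ /eqP v0]; move: P00.
      by rewrite E v0 scale0r eqxx.
    split; first by move=> i; case: (axis_norm_le1 C i).
      by move=> r s r0 s0 /(mulfI u0)/invr_inj; exact: rcI.
    move=> r x r0; have [-> ->] := uw_coord_shift P0 (w_axis C) (rc r) x.
    by rewrite uc wc w0 mulr0 mulr1 addr0 add0r gt_eqF // rc0.
  exists (u_axis C), (fun r => (ucoord P0 + rc r) / wcoord P0).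
  split; first by move=> i; case: (axis_norm_le1 C i).
    by move=> r s _ _ /(mulIf (invr_neq0 w0))/addrI; exact: rcI.
  move=> r x r0; have [-> ->] := uw_coord_shift P0 (u_axis C) (rc r) x.
  by rewrite ua wa mulr0 mulr1 addr0.
pose q := line_poly F P0 B.
have [M M0 qM] : exists2 M, 0 < M & forall a, `|a| <= 1 -> `|q.[a]| <= M * `|a|.
  by apply: horner_near0; rewrite /q horner_line_poly scale0r addr0.
pose c := `|feval F idfun (v_axis C)|; have c0 : 0 < c by rewrite normr_gt0.
pose e2 := e / 2; have e20 : 0 < e2 by rewrite divr_gt0 ?ltr0n.
pose b1 := c * e2 ^+ d / M.
have b10 : 0 < b1 by rewrite divr_gt0 // mulr_gt0 // exprn_gt0.
have real_of (z : C) : 0 < z -> exists2 r, 0 < r & rc r = z.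
  move=> z0; exists (complex.Re z); last by apply: RRe_real; rewrite gtr0_real.
  by move: z0; rewrite ltcE => /andP[].
have [r1 r10 r1E] := real_of _ b10; have [r2 r20 r2E] := real_of _ e20.
pose dl := Num.min 1 (Num.min r1 r2).
have dl0 : 0 < dl by rewrite !lt_min ltr01 r10 r20.
have [r /andP[r0 rdl] rS] := interval_avoids_sequence S dl0 injf.
move: rdl; rewrite !lt_min => /and3P[r_1 r_r1 r_r2].
pose a := rc r; have a0 : 0 < a by apply: rc0.
have na : `|a| = a by rewrite gtr0_norm.
have a1 : `|a| <= 1 by rewrite na -[1]/(rc 1) lecR ltW.
have ab1 : a < b1 by rewrite -r1E ltcR.
have ae2 : a < e2 by rewrite -r2E ltcR.
pose p := line_poly F (P0 + a *: B) (v_axis C).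
have [p0 pl] := line_poly_lead homF (P0 + a *: B) Fv.
have sp : (size p).-1 = d.
  have [s _] := line_poly_bounded homF (P0 + a *: B) (v_axis C).
  apply/eqP; rewrite eqn_leq -ltnS prednK ?size_poly_gt0 // s /=.
  rewrite leqNgt; apply/negP => lt; move: Fv.
  rewrite -(line_poly_bounded homF (P0 + a *: B) (v_axis C)).2 nth_default ?eqxx //.
  by rewrite -/p -[size p]prednK ?size_poly_gt0.
have [|x px xe] := @exists_small_root C p e2 (ltW e20).
  rewrite sp /p pl -/c horner_line_poly scale0r addr0.
  have := qM a a1; rewrite /q horner_line_poly na => /le_lt_trans; apply.
  by rewrite mulrC -ltr_pdivlMr.
exists (P0 + a *: B + x *: v_axis C); split.
- move=> i; rewrite shift_entry normrN.
  rewrite (le_lt_trans (ler_normD _ _)) // !normrM na.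
  rewrite (_ : e = e2 + e2); last by rewrite /e2; field.
  rewrite ltrD //.
    by rewrite (le_lt_trans _ ae2) // ler_piMr ?(ltW a0) // Bax.
  apply: (le_lt_trans _ xe); apply: ler_piMr; first exact: normr_ge0.
  by have [_ h _] := axis_norm_le1 C i; exact: h.
- by rewrite -horner_line_poly; apply/eqP.
- by have [] := fE r x r0.
- by move=> n; have [_ ->] := fE r x r0; exact: rS.
Qed.

End Nearby.

(** * Fields of definition of points and lines *)

Section Advance.
Variable C : numClosedFieldType.
Implicit Types P Q : 'rV[C]_3.

Definition upos P : C := ucoord P / wcoord P.
Definition vpos P : C := vcoord P / wcoord P.

Lemma uposZ c P : c != 0 -> upos (c *: P) = upos P.
Proof. by move=> c0; rewrite /upos ucoordZ wcoordZ -mulf_div divff // mul1r. Qed.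
Lemma vposZ c P : c != 0 -> vpos (c *: P) = vpos P.
Proof. by move=> c0; rewrite /vpos vcoordZ wcoordZ -mulf_div divff // mul1r. Qed.

Definition axes_in (K : divringClosed C) :=
  [/\ forall i, u_axis C 0 i \in K, forall i, v_axis C 0 i \in K &
      forall i, w_axis C 0 i \in K].

Lemma axes_inP (K : divringClosed C) : 'i \in K -> axes_in K.
Proof.
move=> iK; have h2 : 2^-1 \in K by rewrite rpredV rpred_nat.
by split=> i; rewrite mxE; case: i => [[|[|[|//]]] iP] /=;
  rewrite ?rpred0 ?rpred1 ?rpredM ?rpredN.
Qed.

Lemma axes_in_sub (K E : divringClosed C) : {subset K <= E} -> axes_in K -> axes_in E.
Proof. by move=> KE [uK vK wK]; split=> i; apply: KE; [exact: uK|exact: vK|exact: wK]. Qed.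

Lemma upos_eq P Q : wcoord P != 0 -> wcoord Q != 0 -> udir P Q = 0 -> upos Q = upos P.
Proof.
move=> P0 Q0 /eqP; rewrite subr_eq0 => /eqP e; apply/eqP.
by rewrite /upos eqr_div // mulrC e mulrC.
Qed.

Variables (F : mpoly.mpoly 3 C) (d : nat) (K : divringClosed C).
Hypothesis homF : F \is mpoly.ishomog1 d mpoly.mdeg.
Hypothesis FK : forall n, mpoly.mcoeff n F \in K.
Hypothesis axK : axes_in K.
Hypothesis Fu : feval F idfun (u_axis C) != 0.
Hypothesis Fv : feval F idfun (v_axis C) != 0.
Local Notation ev P := (feval F idfun P).
Local Notation pt x y w := (x *: u_axis C + y *: v_axis C + w *: w_axis C).

Lemma pt_in (S : subringClosed C) x y w i : {subset K <= S} ->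
  x \in S -> y \in S -> w \in S -> (pt x y w) 0 i \in S.
Proof.
move=> KS xS yS wS; have [] := axK.
move: (u_axis C) (v_axis C) (w_axis C) => eu ev ew uK vK wK.
by rewrite !mxE !rpredD ?rpredM // KS.
Qed.

Lemma affine_form P : wcoord P != 0 -> ev P = 0 -> ev (pt (upos P) (vpos P) 1) = 0.
Proof.
move=> w0 P0; have -> : pt (upos P) (vpos P) 1 = (wcoord P)^-1 *: P.
  rewrite {4}(isotropic_decomposition P) !scalerDr !scalerA mulVf //.
  by rewrite /upos /vpos ![_ / wcoord P]mulrC.
by rewrite (fevalZ homF) P0 mulr0.
Qed.

(** v is a root of F(u, Y, 1), whose leading coefficient F(v_axis) is a
    nonzero constant. *)
Lemma vpos_algebraic (E : divringClosed C) P : {subset K <= E} -> alg_closed_in E ->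
  wcoord P != 0 -> ev P = 0 -> upos P \in E -> vpos P \in E.
Proof.
move=> KE aE w0 P0 uE; have [uK vK wK] := axK.
have [p0 _] := line_poly_lead homF (upos P *: u_axis C + w_axis C) Fv.
apply: aE p0 _; last first.
  rewrite /root horner_line_poly addrAC -[w_axis C]scale1r.
  by rewrite (affine_form w0 P0).
apply: line_poly_over => [n|i|i]; try exact/KE.
by rewrite mxE rpredD //; [rewrite mxE rpredM // KE|exact/KE].
Qed.

Section Step.
Variable V : subringClosed C.
Hypotheses (valV : is_valuation V) (KV : {subset K <= V}) (aK : alg_closed_in K).
Local Notation rt := (residually_transcendental V K).

Lemma vpos_residually_transcendental P : wcoord P != 0 -> ev P = 0 ->
  rt (upos P) -> rt (vpos P).
Proof.
move=> w0 P0 tu; have [uK vK wK] := axK.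
apply: (curve_residually_transcendental valV KV aK homF FK vK uK wK Fv Fu tu).
by rewrite [X in X + _]addrC; exact: affine_form.
Qed.

(** The specialization step along an edge that becomes parallel to the u-axis. *)
Lemma advance_u P Q : wcoord P != 0 -> rt (upos P) -> rt (vpos P) -> ev Q = 0 ->
  udir P Q != 0 -> vdir P Q / udir P Q \in nonunits V ->
  [/\ wcoord Q != 0, rt (upos Q) & rt (vpos Q)].
Proof.
move=> w0 tu tv Q0 d0 sm; have [uK vK wK] := axK.
have du : ucoord Q - wcoord Q * upos P = udir P Q / wcoord P.
  by rewrite /upos /udir; field.
have dv : vcoord Q - wcoord Q * vpos P = vdir P Q / wcoord P.
  by rewrite /vpos /vdir; field.
apply: (specialization_step valV KV aK homF FK uK vK wK Fu Fv tu tv).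
- by rewrite -isotropic_decomposition.
- by rewrite du mulf_neq0 // invr_eq0.
- by rewrite du dv -mulf_div divff ?mulr1 // invr_eq0.
Qed.

(** The specialization step along an edge that becomes parallel to the v-axis. *)
Lemma advance_v P Q : wcoord P != 0 -> rt (upos P) -> rt (vpos P) -> ev Q = 0 ->
  vdir P Q != 0 -> udir P Q / vdir P Q \in nonunits V ->
  [/\ wcoord Q != 0, rt (upos Q) & rt (vpos Q)].
Proof.
move=> w0 tu tv Q0 d0 sm; have [uK vK wK] := axK.
have du : ucoord Q - wcoord Q * upos P = udir P Q / wcoord P.
  by rewrite /upos /udir; field.
have dv : vcoord Q - wcoord Q * vpos P = vdir P Q / wcoord P.
  by rewrite /vpos /vdir; field.
suff [? ? ?] : [/\ wcoord Q != 0, rt (vpos Q) & rt (upos Q)] by [].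
apply: (specialization_step valV KV aK homF FK vK uK wK Fv Fu tv tu).
- by rewrite [X in X + _]addrC -isotropic_decomposition.
- by rewrite dv mulf_neq0 // invr_eq0.
- by rewrite du dv -mulf_div divff ?mulr1 // invr_eq0.
Qed.

End Step.

(** The line PQ is defined over K1, and it contains Q, a point of the curve
    not defined over K1; so the line lies on the curve. Its slope is then
    a root of the form at infinity and its intersection with the v-axis
    lies on the curve: both are algebraic over K. *)
Lemma line_over_subfield (K1 : divringClosed C) P Q : {subset K <= K1} -> alg_closed_in K ->
  alg_closed_in K1 -> wcoord P != 0 -> wcoord Q != 0 -> ev Q = 0 ->
  upos P \in K1 -> vpos P \in K1 -> upos Q \notin K1 -> udir P Q != 0 ->
  let s := vdir P Q / udir P Q in s \in K1 -> s \in K /\ vpos P - s * upos P \in K.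
Proof.
move=> KK1 aK aK1 P0 Q0 FQ uP vP uQ d0 s sK1; have [uK vK wK] := axK.
have sE : vpos Q - vpos P = s * (upos Q - upos P).
  rewrite /s; have -> : upos Q - upos P = udir P Q / (wcoord P * wcoord Q).
    by rewrite /upos /udir; field; rewrite P0 Q0.
  rewrite mulrA divfK // /vpos /vdir; field; by rewrite P0 Q0.
clearbody s.
pose A := pt (upos P) (vpos P) 1; pose B := u_axis C + s *: v_axis C.
pose l := line_poly F A B.
have lx x : l.[x] = ev (pt (upos P + x) (vpos P + s * x) 1).
  rewrite /l horner_line_poly; congr feval; rewrite /A /B.
  by apply/rowP => i; rewrite !mxE; ring.
have lK1 : l \is a polyOver K1.
  apply: line_poly_over => [n|i|i]; first exact/KK1.
    by apply: pt_in => //; exact: rpred1.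
  rewrite mxE; apply: rpredD; first exact/KK1/uK.
  by rewrite mxE; apply: rpredM => //; exact/KK1/vK.
have l0 : l = 0.
  apply/eqP/negPn/negP => l0; case/negP: uQ.
  rewrite -[upos Q](subrK (upos P)) rpredD //; apply: (aK1 _ _ lK1 l0).
  rewrite /root lx [upos P + _]addrC subrK -sE [vpos P + _]addrC subrK.
  by rewrite (affine_form Q0 FQ).
have FB : ev B = 0 by have [_ <-] := line_poly_bounded homF A B; rewrite -/l l0 coef0.
have sK : s \in K.
  have [p0 _] := line_poly_lead homF (u_axis C) Fv.
  apply: (aK _ _ _ p0); first by apply: line_poly_over.
  by rewrite /root horner_line_poly FB.
split=> //.
have [p0 _] := line_poly_lead homF (w_axis C) Fv.
apply: (aK _ _ _ p0); first by apply: line_poly_over.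
have := lx (- upos P); rewrite l0 horner0 subrr scale0r add0r scale1r mulrN addrC.
by rewrite /root horner_line_poly => <-.
Qed.

End Advance.

(** * Branches of mirrors *)

Section Branches.
Local Open Scope classical_set_scope.
Variable R : realType.
Local Notation C := (Cplx R).

Definition curve_form (a : plane_curve R) : 'rV[C]_3 -> C :=
  feval (curve_poly a) idfun.

Lemma curve_setE a p : curve_set a p <-> curve_form a (coords p) = 0.
Proof. by []. Qed.

Lemma curve_set_hpoint a (P : 'rV[C]_3) : P != 0 -> curve_form a P = 0 ->
  curve_set a (hpoint P).
Proof.
move=> P0 F0; apply/curve_setE; have [c c0 ->] := hpointP P0.
by rewrite /curve_form (fevalZ (curve_homog a)) [feval _ _ _]F0 mulr0.
Qed.

Lemma curve_form_axes a : ~ curve_set a I1 -> ~ curve_set a I2 ->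
  curve_form a (u_axis C) != 0 /\ curve_form a (v_axis C) != 0.
Proof.
have key (y : C) : ~ curve_set a (hpoint (vec 1 y 0)) ->
    curve_form a (vec 2^-1 (y / 2) 0) != 0.
  have [E v0] := vec_isotropic y.
  move=> nI; apply/eqP => F0; apply: nI; apply: (curve_set_hpoint v0).
  by rewrite E /curve_form (fevalZ (curve_homog a)) [feval _ _ _]F0 mulr0.
by move=> h1 h2; split; [exact: key h2|exact: key h1].
Qed.

Section OneBranch.
Variables (a : plane_curve R) (b : branch a).
Let A0 := arc b 0%N.
Let B := arc b (arc_order b).
Hypothesis A0w : wcoord A0 != 0.

Lemma branch_dir : (udir A0 B != 0) || (vdir A0 B != 0).
Proof.
rewrite -negb_and; apply/negP => /andP[/eqP h1 /eqP h2].
have := arc_at_order b; rewrite -/A0 -/B (dir0_prop A0w h1 h2).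
by rewrite scalemx_sub.
Qed.

Hypothesis udir0 : udir A0 B != 0.
Let t := vdir A0 B / udir A0 B.

Let order_gt0 : (0 < arc_order b)%N.
Proof. by rewrite lt0n; apply/eqP => E; have := arc_at_order b; rewrite E submx_refl. Qed.

Let low n : (n < arc_order b)%N ->
  ucoord (arc b n) = upos A0 * wcoord (arc b n) /\ vcoord (arc b n) = vpos A0 * wcoord (arc b n).
Proof.
move=> /arc_lt_order/sub_rVP[c ->]; rewrite !(ucoordZ, vcoordZ, wcoordZ) /upos /vpos -/A0.
by split; field.
Qed.

Let xm : ucoord B - upos A0 * wcoord B = udir A0 B / wcoord A0.
Proof. by rewrite /upos /udir; field. Qed.

Let ym : vcoord B - vpos A0 * wcoord B = t * (ucoord B - upos A0 * wcoord B).
Proof. by rewrite xm /t mulrA divfK // /vpos /vdir; field. Qed.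

Let xm0 : ucoord B - upos A0 * wcoord B != 0.
Proof. by rewrite xm mulf_neq0 // invr_eq0. Qed.

Let arcF N : 'X^N %| feval (curve_poly a) polyC
  (basis_point (u_axis C) (v_axis C) (w_axis C) (@polyC C) (\poly_(n < N) ucoord (arc b n))
    (\poly_(n < N) vcoord (arc b n)) (\poly_(n < N) wcoord (arc b n))).
Proof.
apply: dvd_polyXn => n nN; rewrite -[RHS](@arc_vanish _ _ b N n nN).
congr (nth _ (polyseq _) _); rewrite /feval; congr mpoly.mmap; apply/funext => i.
exact: basis_point_truncation.
Qed.

Lemma branch_slope_algebraic (E : divringClosed C) : alg_closed_in E ->
  (forall n, mpoly.mcoeff n (curve_poly a) \in E) ->
  (forall i, u_axis C 0 i \in E) -> (forall i, v_axis C 0 i \in E) ->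
  (forall i, w_axis C 0 i \in E) -> upos A0 \in E -> vpos A0 \in E ->
  curve_form a (u_axis C) != 0 -> t \in E.
Proof.
move=> aE FE uE vE wE hu hv Fu.
exact: (tangent_slope_algebraic (curve_homog a) order_gt0 A0w low xm0 ym arcF aE
  FE uE vE wE hu hv Fu).
Qed.

Lemma branch_slope_line (K : divringClosed C) al be : alg_closed_in K ->
  (forall n, mpoly.mcoeff n (curve_poly a) \in K) ->
  (forall i, u_axis C 0 i \in K) -> (forall i, v_axis C 0 i \in K) ->
  (forall i, w_axis C 0 i \in K) -> upos A0 \notin K -> al \in K -> be \in K ->
  vpos A0 = al * upos A0 + be -> curve_form a (v_axis C) != 0 -> t = al.
Proof.
move=> aK FK uK vK wK hu alK beK hv Fv.
exact: (tangent_slope_of_line (curve_homog a) order_gt0 A0w low xm0 ym arcF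
  aK FK uK vK wK hu alK beK hv Fv).
Qed.

End OneBranch.

Lemma span_line_slope (c t : C) A B A' B' : wcoord A != 0 -> c != 0 -> A' = c *: A ->
  udir A B != 0 -> udir A' B' != 0 -> vdir A B = t * udir A B ->
  vdir A' B' = t * udir A' B' -> span_line A B = span_line A' B' :> set (CP2 R).
Proof.
move=> A0 c0 AA d0 d0' e e'.
have A0' : wcoord A' != 0 by rewrite AA wcoordZ mulf_neq0.
rewrite /span_line; apply/seteqP; split=> p /=.
  move/(on_lineP _ A0); rewrite d0 => /(_ isT); rewrite e mulrA => /(mulIf d0) h.
  by apply/on_lineP; rewrite ?d0' // e' AA udirZl vdirZl -h; ring.
move/(on_lineP _ A0'); rewrite d0' => /(_ isT); rewrite e' mulrA => /(mulIf d0').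
rewrite AA udirZl vdirZl -mulrA => /(mulfI c0) h.
by apply/on_lineP; rewrite ?d0 // e mulrA h.
Qed.

End Branches.

(** * Orbits *)

Section Orbits.
Variables (R : realType) (k : nat) (a : 'I_k -> plane_curve R).
Local Notation C := (Cplx R).
Variables (A : 'I_k -> CP2 R) (b : forall j, branch (a j)).
Hypothesis orb : periodic_orbit A b.
Local Notation cA j := (coords (A j)).

(** All that is used of an orbit at a vertex, in terms of the slope t of the
    tangent: the reflection law, the field of definition of t, its value
    when the vertex is a generic point of a line over K, and
    transversality. *)
Lemma orbit_vertex j : wcoord (cA j) != 0 -> curve_form (a j) (u_axis C) != 0 ->
    curve_form (a j) (v_axis C) != 0 -> exists t : C,
  [/\ t != 0,
    exists2 c, c != 0 & udir (cA j) (cA (ordS j)) = c * vdir (cA j) (cA (ord_pred j)) /\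
      vdir (cA j) (cA (ordS j)) = c * t ^+ 2 * udir (cA j) (cA (ord_pred j)),
    forall E : divringClosed C, alg_closed_in E ->
      (forall n, mpoly.mcoeff n (curve_poly (a j)) \in E) -> axes_in E ->
      upos (cA j) \in E -> vpos (cA j) \in E -> t \in E,
    forall (K : divringClosed C) al be, alg_closed_in K ->
      (forall n, mpoly.mcoeff n (curve_poly (a j)) \in K) -> axes_in K ->
      upos (cA j) \notin K -> al \in K -> be \in K ->
      vpos (cA j) = al * upos (cA j) + be -> t = al
    & udir (cA j) (cA (ordS j)) != 0 ->
      vdir (cA j) (cA (ordS j)) != t * udir (cA j) (cA (ordS j))].
Proof.
move=> w0 Fu Fv; have [[_ ctr] _ nI [_ mT] sym] := orb j.
have [_ ne _ _ _] := orb (ord_pred j); rewrite ord_predK in ne.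
set A0 := arc (b j) 0%N; set B := arc (b j) (arc_order (b j)).
have [c c0 cE] : exists2 c, c != 0 & cA j = c *: A0.
  by rewrite -ctr; apply: hpointP; exact: arc_neq0.
have A0w : wcoord A0 != 0 by move: w0; rewrite cE wcoordZ mulf_eq0 negb_or => /andP[].
have [ud vd] := nonisotropic_dir A0w (branch_dir A0w) nI.
exists (vdir A0 B / udir A0 B); split.
- by rewrite mulf_neq0 // invr_eq0.
- have ex : exists2 c, c != 0 & cA j = c *: A0 by exists c.
  exact: (reflection_law w0 ex erefl ud vd ne sym).
- move=> E aE FE [uE vE wE]; rewrite cE uposZ // vposZ // => hu hv.
  exact: (branch_slope_algebraic A0w ud aE FE uE vE wE hu hv Fu).
- move=> K al be aK FK [uK vK wK]; rewrite cE uposZ // vposZ // => hu alK beK hv.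
  exact: (branch_slope_line A0w ud aK FK uK vK wK hu alK beK hv Fv).
- move=> ud'; apply/eqP => e; apply: mT.
  apply: esym; apply: (span_line_slope A0w c0 cE ud ud' _ e).
  by rewrite divfK.
Qed.

End Orbits.

Section Valuation.
Variables (R : realType) (k : nat) (a : 'I_k -> plane_curve R).
Local Notation C := (Cplx R).
Variables (A : 'I_k -> CP2 R) (b : forall j, branch (a j)).
Hypothesis orb : periodic_orbit A b.
Local Notation cA j := (coords (A j)).
Variables (K : divringClosed C) (V : subringClosed C).
Hypotheses (aK : alg_closed_in K) (valV : is_valuation V) (KV : {subset K <= V}).
Hypothesis FK : forall j n, mpoly.mcoeff n (curve_poly (a j)) \in K.
Hypothesis axK : axes_in K.
Hypothesis Fuv : forall j, curve_form (a j) (u_axis C) != 0 /\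
  curve_form (a j) (v_axis C) != 0.
Local Notation m := (nonunits V).
Local Notation rt := (residually_transcendental V K).

Lemma on_curve j : curve_form (a j) (cA j) = 0.
Proof. by have [[]] := orb j. Qed.

(** Modulo the maximal ideal, the direction (p : q) is that of I2 if par
    holds, and that of I1 otherwise. *)
Definition isotropic_slope (par : bool) (p q : C) :=
  [/\ p != 0, q != 0 & if par then q / p \in m else p / q \in m].

Definition isotropic_reduction (n : nat) (j : 'I_k) :=
  [/\ wcoord (cA j) != 0, rt (upos (cA j)), rt (vpos (cA j)) &
    isotropic_slope (odd n) (udir (cA (ord_pred j)) (cA j)) (vdir (cA (ord_pred j)) (cA j))].

Lemma isotropic_reduction_of_edge n i j : ord_pred j = i -> wcoord (cA i) != 0 ->
  rt (upos (cA i)) -> rt (vpos (cA i)) ->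
  isotropic_slope (odd n) (udir (cA i) (cA j)) (vdir (cA i) (cA j)) -> isotropic_reduction n j.
Proof.
move=> ij w0 tu tv sl; rewrite /isotropic_reduction ij.
have Fj := on_curve j; have [Fu Fv] := Fuv j; have hF := curve_homog (a j).
suff [? ? ?] : [/\ wcoord (cA j) != 0, rt (upos (cA j)) & rt (vpos (cA j))] by [].
case: sl => p0 q0; case: (odd n) => sm.
  exact: (advance_u hF (FK j) axK Fu Fv valV KV aK w0 tu tv Fj p0 sm).
exact: (advance_v hF (FK j) axK Fu Fv valV KV aK w0 tu tv Fj q0 sm).
Qed.

(** Since t^2 is a unit of V, the relation s s' = t^2 exchanges slopes that
    vanish modulo the maximal ideal with slopes that are infinite. *)
Lemma isotropic_reduction_next n j : isotropic_reduction n j -> isotropic_reduction n.+1 (ordS j).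
Proof.
move=> [w0 tu tv [p0 q0 sm]]; have [Fu Fv] := Fuv j.
have [t [t0 [c c0 [hu hv]] tE _ _]] := orbit_vertex orb w0 Fu Fv.
have [E [KE uE aE EV]] := residually_transcendental_field valV KV aK tu.
have axE := axes_in_sub KE axK.
have vE := vpos_algebraic (curve_homog (a j)) (FK j) axK Fv KE aE w0 (on_curve j) uE.
have FE n' : mpoly.mcoeff n' (curve_poly (a j)) \in E := KE _ (FK j n').
have {}tE : t \in E := tE E aE FE axE uE vE.
have t2V : t ^+ 2 \in V by apply/EV/rpredX.
have t2V' : t ^- 2 \in V by apply: EV; rewrite rpredV rpredX.
apply: (isotropic_reduction_of_edge (ordSK j) w0 tu tv).
rewrite vdirN mulrN -mulNr in hu; rewrite udirN mulrN -mulNr -mulNr in hv.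
move: p0 q0 sm hu hv; set p := udir _ (cA j); set q := vdir _ (cA j).
set p' := udir _ _; set q' := vdir _ _ => p0 q0 sm hu hv.
have p'0 : p' != 0 by rewrite hu mulf_neq0 // oppr_eq0.
have q'0 : q' != 0 by rewrite hv !mulf_neq0 ?oppr_eq0 // expf_neq0.
split=> //=; case: (odd n) sm => /= sm.
  have -> : p' / q' = t ^- 2 * (q / p).
    by rewrite hu hv; field; rewrite t0 p0 c0.
  exact: nonunitsM.
have -> : q' / p' = t ^+ 2 * (p / q) by rewrite hu hv; field; rewrite q0 c0.
exact: nonunitsM.
Qed.

(** The same edge cannot have both a zero and an infinite slope. *)
Lemma isotropic_reduction_parity n j : ~~ odd n ->
  isotropic_reduction 1 j -> isotropic_reduction n j -> False.
Proof.
move=> on [_ _ _ [p0 q0 s1]] [_ _ _ [_ _]]; rewrite (negbTE on) => s2.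
have := nonunitsM (nonunits_sub valV s2) s1.
by rewrite mulf_div [X in X / _]mulrC divff ?mulf_neq0 // (negbTE (nonunits_one V)).
Qed.

Lemma iter_ordS n (j : 'I_k) : iter n (@ordS k) j = ((j + n) %% k)%N :> nat.
Proof.
elim: n => [|n IH]; first by rewrite addn0 modn_small.
by rewrite iterS /= IH addnS -addn1 modnDml addn1.
Qed.

Lemma iter_ordS_k j : iter k (@ordS k) j = j.
Proof. by apply/val_inj; rewrite /= iter_ordS modnDr modn_small. Qed.

(** Going once around the orbit changes the parity of n, since k is odd. *)
Lemma no_isotropic_reduction j : odd k ->
  wcoord (cA j) != 0 -> rt (upos (cA j)) -> rt (vpos (cA j)) ->
  udir (cA j) (cA (ordS j)) != 0 -> vdir (cA j) (cA (ordS j)) != 0 ->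
  vdir (cA j) (cA (ordS j)) / udir (cA j) (cA (ordS j)) \in m -> False.
Proof.
move=> ok w0 tu tv p0 q0 sm.
have base : isotropic_reduction 1 (ordS j) by apply: (isotropic_reduction_of_edge (ordSK j)).
have all n : isotropic_reduction n.+1 (iter n.+1 (@ordS k) j).
  by elim: n => [//|n IH]; exact: isotropic_reduction_next.
have := all k; rewrite iterS iter_ordS_k.
by apply: (isotropic_reduction_parity _ base) => //=; rewrite negbK.
Qed.

End Valuation.

Section Transcendental.
Variables (R : realType) (k : nat) (a : 'I_k -> plane_curve R).
Local Notation C := (Cplx R).
Variables (A : 'I_k -> CP2 R) (b : forall j, branch (a j)).
Hypothesis orb : periodic_orbit A b.
Local Notation cA j := (coords (A j)).

(** This is the contradiction described at the beginning: A_j is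
    transcendental over the field of definition K of the mirrors, and its
    successor over K1, which contains the coordinates of A_j. *)
Lemma generic_orbit_contradiction (K K1 : divringClosed C) j : odd k ->
  alg_closed_in K -> alg_closed_in K1 -> {subset K <= K1} ->
  (forall j n, mpoly.mcoeff n (curve_poly (a j)) \in K) -> axes_in K ->
  (forall j, curve_form (a j) (u_axis C) != 0 /\ curve_form (a j) (v_axis C) != 0) ->
  wcoord (cA j) != 0 -> wcoord (cA (ordS j)) != 0 ->
  upos (cA j) \notin K -> upos (cA j) \in K1 -> upos (cA (ordS j)) \notin K1 -> False.
Proof.
move=> ok aK aK1 KK1 FK axK Fuv w0 w1 uK uK1 uK1'.
have [Fu Fv] := Fuv j; have [Fu' Fv'] := Fuv (ordS j).
have Fj := on_curve orb j; have Fj' := on_curve orb (ordS j).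
have vK1 := vpos_algebraic (curve_homog (a j)) (FK j) axK Fv KK1 aK1 w0 Fj uK1.
have p0 : udir (cA j) (cA (ordS j)) != 0.
  apply/eqP => p0; case/negP: uK1'.
  by rewrite (upos_eq w0 w1 p0).
set s := vdir (cA j) (cA (ordS j)) / udir (cA j) (cA (ordS j)).
have sK1 : s \notin K1.
  apply/negP => sK1; have [t [_ _ _ tline nT]] := orbit_vertex orb w0 Fu Fv.
  have [sK beK] := line_over_subfield (curve_homog (a (ordS j))) (FK (ordS j)) axK Fv'
     KK1 aK aK1 w0 w1 Fj' uK1 vK1 uK1' p0 sK1.
  have ts : t = s.
    by apply: (tline K s _ aK (FK j) axK uK sK beK); rewrite addrC subrK.
  by move: (nT p0); rewrite ts divfK // eqxx.
have [V [valV K1V sm]] := exists_valuation aK1 sK1.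
have KV : {subset K <= V} by move=> x /KK1/K1V.
have rt x : x \in K1 -> x \notin K -> residually_transcendental V K x.
  move=> xK1 xK; split=> [|c cK]; first exact: K1V.
  apply: (subfield_unit K1V); first by rewrite rpredB // KK1.
  by rewrite subr_eq0; apply: contra xK => /eqP ->.
have tu := rt _ uK1 uK.
have tv : residually_transcendental V K (vpos (cA j)).
  exact: (vpos_residually_transcendental (curve_homog (a j)) (FK j) axK Fu Fv valV KV aK w0 Fj tu).
have q0 : vdir (cA j) (cA (ordS j)) != 0.
  by apply: contra sK1 => /eqP q0; rewrite /s q0 mul0r rpred0.
exact: (no_isotropic_reduction orb aK valV KV FK axK Fuv ok w0 tu tv p0 q0 sm).
Qed.

End Transcendental.

Section Main.
Local Open Scope classical_set_scope.
Variable R : realType.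
Local Notation C := (Cplx R).

Lemma countable_field_of_definition k (a : 'I_k -> plane_curve R) :
  exists (K : divringClosed C) (f : nat -> C), [/\ alg_closed_in K,
    forall j n, mpoly.mcoeff n (curve_poly (a j)) \in K, axes_in K &
    forall x, x \in K -> exists n, x = f n].
Proof.
pose s : seq C := 'i :: flatten [seq [seq mpoly.mcoeff n (curve_poly (a j))
  | n <- mpoly.msupp (curve_poly (a j))] | j <- enum 'I_k].
have [K [f [aK sK Kf]]] := countable_alg_closed (nth 0 s).
exists K, f; split=> // [j n|]; last first.
  by apply: axes_inP; exact: (sK 0%N).
have [nF|nF] := boolP (n \in mpoly.msupp (curve_poly (a j))); last first.
  by rewrite mpoly.memN_msupp_eq0 // rpred0.
have cs : mpoly.mcoeff n (curve_poly (a j)) \in s.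
  rewrite inE; apply/orP; right; apply/flattenP.
  exists [seq mpoly.mcoeff n (curve_poly (a j)) | n <- mpoly.msupp (curve_poly (a j))].
    by apply/mapP; exists j => //; rewrite mem_enum.
  by apply/mapP; exists n.
by rewrite -(nth_index 0 cs).
Qed.

Lemma nearby_generic_curve_point (a : plane_curve R) (U : set (CP2 R)) p (S : nat -> C) :
  open U -> U p -> curve_set a p -> curve_form a (v_axis C) != 0 ->
  exists q, [/\ U q, curve_set a q, wcoord (coords q) != 0 &
    forall n, upos (coords q) <> S n].
Proof.
move=> oU Up ap Fv; have [e e0 eU] := open_CP2_ball oU Up.
have [Q [Qe FQ wQ uQ]] :=
  nearby_generic_point S (curve_homog a) Fv (coords_neq0 p) ap e0.
have Q0 : Q != 0.
  by apply: contra wQ => /eqP ->; rewrite -[0]/(0 : 'rV[C]_3) -(scale0r 0) wcoordZ mul0r.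
exists (hpoint Q); have [c c0 cE] := hpointP Q0.
split; [exact: eU|exact: curve_set_hpoint| |].
  by rewrite cE wcoordZ mulf_neq0.
by move=> n; rewrite cE uposZ //; exact: uQ.
Qed.

End Main.

Theorem theorem1p9 (R : realType) (k : nat) (k_odd : odd k)
    (a : 'I_k -> plane_curve R) (a_billiard : algebraic_billiard a)
    (a_avoids_isotropic_points :
       forall j : 'I_k, ~ curve_set (a j) I1 /\ ~ curve_set (a j) I2) :
  ~ reflective (odd_gt0 k_odd) a.
Proof.
have Fuv j : curve_form (a j) (u_axis (Cplx R)) != 0 /\
    curve_form (a j) (v_axis (Cplx R)) != 0.
  by have [h1 h2] := a_avoids_isotropic_points j; exact: curve_form_axes.
move=> [O [oO [[P1 P2] [OP [/= aP1 aP2]]] Oorb]].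
set j1 := Ordinal _ in aP1 aP2 Oorb.
have [[V1 V2] /= [nV1 nV2] V12] : nbhs (P1, P2) O by apply: open_nbhs_nbhs.
have [K [f [aK FK axK Kf]]] := countable_field_of_definition a.
have [Q1 [VQ1 aQ1 wQ1 uQ1]] := nearby_generic_curve_point f
  (@open_interior _ V1) nV1 aP1 (Fuv _).2.
pose f1 n := if n is n'.+1 then f n' else upos (coords Q1).
have [K1 [g [aK1 fK1 K1g]]] := countable_alg_closed f1.
have [Q2 [VQ2 aQ2 wQ2 uQ2]] := nearby_generic_curve_point g
  (@open_interior _ V2) nV2 aP2 (Fuv _).2.
have OQ : O (Q1, Q2) by apply: V12; split; exact: interior_subset.
have [A [b [orb A1 A2]]] := Oorb Q1 Q2 OQ aQ1 aQ2.
apply: (generic_orbit_contradiction (j := j1) orb k_odd aK aK1 _ FK axK Fuv);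
  rewrite ?A1 ?A2 //.
- by move=> x /Kf[n ->]; exact: (fK1 n.+1).
- by apply/negP => /Kf[n]; exact: uQ1.
- exact: (fK1 0%N).
- by apply/negP => /K1g[n]; exact: uQ2.
Qed.
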